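(* Let $G$ be a countable directed graph. The following are equivalent: (1) $\mathfrak L_G$ is semisimple; (2) $\mathfrak L_G$ is strongly semisimple; (3) $G$ is transitive in each component. Moreover, if $\mathcal V(G)$ is finite, then the Jacobson radical of $\mathfrak L_G$ is equal to the strong radical of $\mathfrak L_G$.
   Context: A countable directed graph $G=(\mathcal V(G),\mathcal E(G),r,s)$ consists of a countable set $\mathcal V(G)$ of vertices, a countable set $\mathcal E(G)$ of edges, and range and source maps $r,s:\mathcal E(G)\to\mathcal V(G)$. A path is a finite sequence of edges $p=e_k\cdots e_2e_1$ with $r(e_i)=s(e_{i+1})$ for $1\le i<k$; $s(p)=s(e_1)$, $r(p)=r(e_k)$. Each vertex $x$ is a path of length $0$ with $s(x)=r(x)=x$. $\mathbb F^+(G)$ is the set of all paths (including vertices); the product $pq$ is defined when $r(q)=s(p)$. Let $\mathcal H_G=\ell^2(\mathbb F^+(G))$ with orthonormal basis $\{\xi_w:w\in\mathbb F^+(G)\}$. For $p\in\mathbb F^+(G)$ let $L_p\xi_w=\xi_{pw}$ if $s(p)=r(w)$ and $L_p\xi_w=0$ otherwise. The free semigroupoid algebra $\mathfrak L_G$ is the algebra generated by $\{L_p:p\in\mathbb F^+(G)\}$, closed in the weak operator topology. $G$ is transitive if there is a path from each vertex to every other vertex. $G$ is connected if the undirected graph determined by $G$ is connected; a connected component is a maximal connected subgraph. $G$ is transitive in each component if each connected component of $G$ is transitive. A Banach algebra is semisimple if its Jacobson radical is $\{0\}$. The strong radical of a Banach algebra is the intersection of all its maximal (two-sided) ideals; the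 algebra is strongly semisimple if its strong radical is $\{0\}$. *)

(* Defs.v *)
From HB Require Import structures.
From Stdlib Require Import Relation_Operators.
From mathcomp Require Import all_boot all_order all_algebra.
From mathcomp Require Import all_classical all_reals all_analysis.
From mathcomp Require Import complex.
From mathcomp Require Import ring lra.

Set Implicit Arguments.
Unset Strict Implicit.
Unset Printing Implicit Defensive.

Import Order.TTheory GRing.Theory Num.Theory.
Import numFieldNormedType.Exports Normc.
Local Open Scope classical_set_scope.
Local Open Scope ring_scope.
Local Open Scope complex_scope.

(** * Directed graphs and their paths *)

Record digraph := Digraph {
  vertex : countType;
  edge : countType;
  src : edge -> vertex;
  rng : edge -> vertex }.

Section Paths.
Variable G : digraph.

(* [is_walk x s]: the edges of [s], listed in the order in which they are
   travelled, form a walk starting at [x]. *)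
Fixpoint is_walk (x : vertex G) (s : seq (edge G)) : bool :=
  if s is e :: s' then (src e == x) && is_walk (rng e) s' else true.

(* The path e_k ... e_2 e_1 is encoded by its source and the list
   [:: e_1; e_2; ...; e_k]; the source is redundant unless k = 0, in which case
   the path is a vertex. *)
Record dipath := Dipath {
  path_data : vertex G * seq (edge G);
  path_dataP : is_walk path_data.1 path_data.2 }.

HB.instance Definition _ := [isSub for path_data].
HB.instance Definition _ := [Countable of dipath by <:].

Definition path_edges (p : dipath) : seq (edge G) := (path_data p).2.
Definition path_source (p : dipath) : vertex G := (path_data p).1.
Definition path_range (p : dipath) : vertex G :=
  last (path_source p) (map (@rng G) (path_edges p)).

(* The product [p q], which travels [q] first and is defined only when
   r(q) = s(p). *)
Definition path_mul (p q : dipath) : option dipath :=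
  if path_range q == path_source p
  then insub (path_source q, path_edges q ++ path_edges p) else None.

Lemma is_walk_cat x s t :
  is_walk x (s ++ t) = is_walk x s && is_walk (last x (map (@rng G) s)) t.
Proof. by elim: s x => //= e s IHs x; rewrite IHs andbA. Qed.

Lemma path_mulE p q : path_range q = path_source p ->
  omap path_data (path_mul p q) =
  Some (path_source q, path_edges q ++ path_edges p).
Proof.
move=> qp; rewrite /path_mul qp eqxx; case: insubP => [u _ <- //|] /=.
rewrite is_walk_cat (path_dataP q) /=.
by rewrite -/(path_edges q) -/(path_source q) -/(path_range q) qp path_dataP.
Qed.

Lemma path_mul_inj p q q' v :
  path_mul p q = Some v -> path_mul p q' = Some v -> q = q'.
Proof.
have E w : path_mul p w = Some v ->
    path_data v = (path_source w, path_edges w ++ path_edges p).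
  move=> wv; have : path_range w = path_source p.
    by move: wv; rewrite /path_mul; case: eqP.
  by move=> /path_mulE; rewrite wv => -[].
move=> /E vq /E; rewrite vq => -[sqq' eqq']; apply: val_inj => /=.
have : size (path_edges q) == size (path_edges q').
  by rewrite -(eqn_add2r (size (path_edges p))) -!size_cat eqq'.
move=> /eqP szq; move/eqP: eqq'; rewrite eqseq_cat // => /andP[/eqP eqq' _].
move: sqq' eqq'; rewrite /path_source /path_edges.
by case: (path_data q) (path_data q') => [? ?] [? ?] /= -> ->.
Qed.

End Paths.

(** * Transitivity in each component *)

Section Components.
Variable G : digraph.

Record subgraph := Subgraph {
  sub_vertex : set (vertex G);
  sub_edge : set (edge G);
  sub_source : forall e, sub_edge e -> sub_vertex (src e);
  sub_range : forall e, sub_edge e -> sub_vertex (rng e) }.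

Definition subgraph_le (H K : subgraph) : Prop :=
  sub_vertex H `<=` sub_vertex K /\ sub_edge H `<=` sub_edge K.

Definition connected_subgraph (H : subgraph) : Prop :=
  forall x y, sub_vertex H x -> sub_vertex H y ->
    clos_refl_sym_trans (vertex G)
      (fun a b => exists2 e, sub_edge H e & src e = a /\ rng e = b) x y.

Definition transitive_subgraph (H : subgraph) : Prop :=
  forall x y, sub_vertex H x -> sub_vertex H y ->
    exists p : dipath G, [/\ {in path_edges p, forall e, sub_edge H e},
      path_source p = x & path_range p = y].

Definition connected_component (H : subgraph) : Prop :=
  connected_subgraph H /\
  forall K, connected_subgraph K -> subgraph_le H K -> subgraph_le K H.

Definition transitive_in_each_component : Prop :=
  forall H, connected_component H -> transitive_subgraph H.

End Components.

(** * The Hilbert space l^2(I) *)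

Section Ell2.
Variables (R : realType) (I : choiceType).
Local Notation C := R[i].

Definition square_summable (x : I -> C) : Prop :=
  (\esum_(i in [set: I]) (normc (x i) ^+ 2)%:E < +oo)%E.

Definition square_summable_pred : {pred I -> C} :=
  fun x => `[< square_summable x >].

Lemma square_summableP x :
  reflect (square_summable x) (x \in square_summable_pred).
Proof. exact: asboolP. Qed.

Lemma normcD_sqr (a b : C) :
  normc (a + b) ^+ 2 <= 2 * normc a ^+ 2 + 2 * normc b ^+ 2.
Proof.
case: a b => [a1 a2] [b1 b2] /=.
rewrite !sqr_sqrtr ?addr_ge0 ?sqr_ge0//.
rewrite -subr_ge0.
have -> : 2 * (a1 ^+ 2 + a2 ^+ 2) + 2 * (b1 ^+ 2 + b2 ^+ 2) -
   ((a1 + b1) ^+ 2 + (a2 + b2) ^+ 2) = (a1 - b1) ^+ 2 + (a2 - b2) ^+ 2 by ring.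
by rewrite addr_ge0 ?sqr_ge0.
Qed.

Lemma square_summable_submod : submod_closed square_summable_pred.
Proof.
have nn (x : I -> C) i : (0 <= (normc (x i) ^+ 2)%:E)%E.
  by rewrite lee_fin sqr_ge0.
split.
  apply/square_summableP; rewrite /square_summable esum1 ?ltry// => i _.
  by rewrite [X in X ^+ 2](_ : _ = 0) ?expr0n//; exact: normc0.
move=> a x y /square_summableP sx /square_summableP sy; apply/square_summableP.
pose c := (2 * normc a ^+ 2)%R.
have c0 : 0 <= c by rewrite mulr_ge0// sqr_ge0.
have scale k (f : I -> \bar R) : 0 <= k -> (forall i, 0 <= f i)%E ->
    (\esum_(i in [set: I]) f i < +oo ->
     \esum_(i in [set: I]) (k%:E * f i) < +oo)%E.
  move=> k0 f0 sf.
  apply: (@le_lt_trans _ _ (k%:E * \esum_(i in [set: I]) f i)%E).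
    apply: ge_ereal_sup => _ [X [finX XT] <-].
    rewrite -ge0_mule_fsumr//; apply: lee_wpmul2l; first by rewrite lee_fin.
    by apply: ereal_sup_ubound; exists X.
  by apply: lte_mul_pinfty.
apply: (@le_lt_trans _ _ (\esum_(i in [set: I])
    (c%:E * (normc (x i) ^+ 2)%:E + 2%:E * (normc (y i) ^+ 2)%:E))%E).
  apply: le_esum => i _; rewrite -!EFinM -EFinD lee_fin.
  apply: le_trans (normcD_sqr _ _) _.
  by rewrite /= normcM exprMn /c mulrA.
rewrite esumD//; last 2 first.
- by move=> i _; rewrite mule_ge0// lee_fin.
- by move=> i _; rewrite mule_ge0// lee_fin.
by apply: lte_add_pinfty; apply: scale.
Qed.

HB.instance Definition _ :=
  GRing.isSubmodClosed.Build C (I -> C) square_summable_pred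
    square_summable_submod.

Record ell2 := Ell2 {
  ell2_fun :> I -> C;
  ell2P : ell2_fun \in square_summable_pred }.

HB.instance Definition _ := [isSub for ell2_fun].
HB.instance Definition _ := [Choice of ell2 by <:].
HB.instance Definition _ := [SubChoice_isSubLmodule of ell2 by <:].

Definition ell2_norm (x : ell2) : R :=
  Num.sqrt (fine (\esum_(i in [set: I]) (normc (x i) ^+ 2)%:E)).

(* Sum of an absolutely summable real, resp. complex, family. *)
Definition real_sum (f : I -> R) : R :=
  fine ((\esum_(i in [set: I]) (EFin \o f)^\+ i) -
        (\esum_(i in [set: I]) (EFin \o f)^\- i))%E.

Definition complex_sum (f : I -> C) : C :=
  real_sum (fun i => complex.Re (f i)) +i* real_sum (fun i => complex.Im (f i)).

Definition inner (x y : ell2) : C := complex_sum (fun i => x i * (y i)^*).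

Lemma basis_subproof (i : I) :
  (fun j => (j == i)%:R : C) \in square_summable_pred.
Proof.
apply/square_summableP; rewrite /square_summable.
have -> : (\esum_(j in [set: I]) (normc ((j == i)%:R : C) ^+ 2)%:E =
    \esum_(j in [set i]) (1 : R)%:E)%E.
  rewrite [RHS]esum_mkcond; apply: eq_esum => j _.
  case: eqVneq => [->|ji]; first by rewrite mem_set// normc1 expr1n.
  by rewrite memNset ?normc0 ?expr0n// => /= /eqP; rewrite (negPf ji).
by rewrite esum_set1 ?ltry// lee_fin.
Qed.

(* The orthonormal basis vector xi_i. *)
Definition basis (i : I) : ell2 := Ell2 (basis_subproof i).

End Ell2.

(** * Operators and the weak operator topology *)

Section InitialTopologyClosure.
Variables (K : numFieldType) (X : choiceType) (J : eqType) (f : J -> X -> K^o).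

Let Y : topologicalType :=
  sup_topology (fun j => Topological.class (initial_topology (f j))).

Lemma sup_initial_continuous j : continuous (f j : Y -> K^o).
Proof.
move=> t.
have /cvg_sup/(_ j) tt : nbhs (t : Y) --> (t : Y) by exact: cvg_id.
have cf : {for t, continuous (f j : initial_topology (f j) -> K^o)}.
  exact: initial_continuous.
by move=> V /cf fV; exact: tt fV.
Qed.

Lemma sup_initial_closureP (A : set X) (t : X) :
  closure (A : set Y) t <->
  forall (s : seq J) (e : K), 0 < e ->
    exists2 u, A u & {in s, forall j, `|f j t - f j u| < e}.
Proof.
split=> clt.
  move=> s e e0.
  have ns : nbhs (t : Y) [set u | {in s, forall j, `|f j t - f j u| < e}].
    elim: s => [|j s IHs]; first exact: (@filterE _ (nbhs (t : Y))).
    have nj : nbhs (t : Y) [set u | `|f j t - f j u| < e].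
      exact: (sup_initial_continuous (nbhsx_ballx (f j t) e e0)).
    apply: (@filterS _ (nbhs (t : Y)) _ _ _ _ (filterI nj IHs)).
    move=> u [uj us] i; rewrite inE => /orP[/eqP->|si]; first exact: uj.
    exact: (us i si).
  by have [u [Au us]] := clt _ ns; exists u.
move=> B; rewrite (@nbhsE Y) => -[_ [[W sW <-] [V WV Vt]] UB].
have [F sF VE] := sW _ WV.
pose Fs : seq {classic (set X)} := finmap.enum_fset F.
have [s [e [e0 seF]]] : exists (s : seq J) (e : K), 0 < e /\
    forall u, {in s, forall j, `|f j t - f j u| < e} ->
      {in Fs, forall E : set _, E u}.
  have : {in Fs, forall E : set _, E t /\
      exists j (Q : set K^o), open Q /\ f j @^-1` Q = E}.
    move=> E EF; split; first by move: Vt; rewrite -VE => /(_ E EF).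
    by have /set_mem [j _ [Q oQ QE]] := sF _ EF; exists j, Q.
  elim: Fs => [|E r IHr] Er; first by exists [::], 1.
  have [s [e [e0 IHs]]] :=
    IHr (fun E' rE' => Er E' (@mem_behead _ (E :: r) E' rE')).
  have [Et [j [Q [oQ QE]]]] := Er E (mem_head _ _).
  have /nbhs_ballP[d /= d0 dQ] : nbhs (f j t) Q.
    by apply: open_nbhs_nbhs; split => //; move: Et; rewrite -QE.
  exists (j :: s), (Num.min e d); split.
    by rewrite /Num.min; case: ifP.
  have min_lt x : x \is Num.real -> x < Num.min e d -> x < e /\ x < d.
    move=> xr; rewrite comparable_lt_min; first by move/andP.
    by apply: real_comparable; apply: gtr0_real.
  move=> u us E'; rewrite inE => /orP[/eqP->|]; last first.
    apply: IHs => i si; have := us i; rewrite inE si orbT => /(_ isT).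
    by move=> /(min_lt _ (normr_real _))[].
  rewrite -QE; apply: dQ.
  by have := us j (mem_head _ _) => /(min_lt _ (normr_real _))[].
have [u Au us] := clt s e e0; exists u; split => //.
have Vu : (V : set X) u by rewrite -VE => E EF; exact: (seF u us E EF).
by apply: UB; exists V; [exact: WV | exact: Vu].
Qed.

End InitialTopologyClosure.

Section Operators.
Variables (R : realType) (I : choiceType).
Local Notation C := R[i].
Local Notation H := (ell2 R I).

Definition bounded_operator (T : H -> H) : Prop :=
  linear T /\ exists M : R, forall x, ell2_norm (T x) <= M * ell2_norm x.

(* The coarsest topology making T |-> <T x, y> continuous for all x and y. *)
Definition wot : topologicalType :=
  sup_topology (fun xy : H * H => Topological.class
    (initial_topology (fun T : H -> H => inner (T xy.1) xy.2 : C^o))).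

(* The WOT closure within the algebra B(H) of bounded operators. *)
Definition wot_closure (A : set (H -> H)) : set (H -> H) :=
  [set T | bounded_operator T /\ closure (A : set wot) T].

Lemma normc_complex (z : C) : (normc z)%:C = `|z|.
Proof. by case: z => a b; rewrite normc_def. Qed.

Lemma wot_closureP (A : set (H -> H)) (T : H -> H) :
  wot_closure A T <-> bounded_operator T /\
    forall (s : seq (H * H)) (e : R), 0 < e -> exists2 S, A S &
      {in s, forall xy, normc (inner (T xy.1) xy.2 - inner (S xy.1) xy.2) < e}.
Proof.
split=> -[bT clT]; split=> //.
  move=> s e e0; have e0C : 0 < e%:C by rewrite ltcR.
  have [S AS Ss] := (sup_initial_closureP _ _ _).1 clT s _ e0C.
  by exists S => // xy /Ss; rewrite -normc_complex ltcR.
apply/sup_initial_closureP => s e e0.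
have eE : e = (complex.Re e)%:C by rewrite RRe_real// gtr0_real.
have [|S AS Ss] := clT s (complex.Re e); first by rewrite -ltcR -eE.
by exists S => // xy /Ss; rewrite eE -normc_complex ltcR.
Qed.

End Operators.

(** * Ideals and radicals of an algebra of operators *)

(* The product of two operators is their composition; the algebra A, a set of
   operators, is not required to contain the identity. *)
Section Radicals.
Variables (K : pzRingType) (H : lmodType K).
Implicit Types A M N : set (H -> H).

Definition linear_subspace M : Prop :=
  [/\ M 0, forall a b, M a -> M b -> M (a + b) &
      forall (k : K) a, M a -> M (k *: a)].

Definition subalgebra A : Prop :=
  linear_subspace A /\ forall a b, A a -> A b -> A (a \o b).

Definition left_ideal A M : Prop :=
  [/\ M `<=` A, linear_subspace M & forall a m, A a -> M m -> M (a \o m)].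

Definition ideal A M : Prop :=
  left_ideal A M /\ forall a m, A a -> M m -> M (m \o a).

Definition maximal_in (P : set (H -> H) -> Prop) A M : Prop :=
  [/\ P M, M <> A & forall N, P N -> M `<=` N -> N = M \/ N = A].

(* Automatic when A has a unit (take it for u); without a unit the Jacobson
   radical is the intersection of the maximal modular left ideals only. *)
Definition modular_left A M : Prop :=
  exists2 u, A u & forall a, A a -> M (a - a \o u).

Definition jacobson_radical A : set (H -> H) :=
  [set a | A a /\ forall M,
    maximal_in (left_ideal A) A M -> modular_left A M -> M a].

Definition strong_radical A : set (H -> H) :=
  [set a | A a /\ forall M, maximal_in (ideal A) A M -> M a].

Definition semisimple A : Prop := jacobson_radical A = [set 0].

Definition strongly_semisimple A : Prop := strong_radical A = [set 0].

End Radicals.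

(** * The free semigroupoid algebra *)

Section FreeSemigroupoidAlgebra.
Variables (R : realType) (G : digraph).
Local Notation C := R[i].

Definition fock_space : lmodType C := ell2 R (dipath G).

Local Notation H := fock_space.

Definition left_mul_fun (p : dipath G) (x : dipath G -> C) : dipath G -> C :=
  fun v => if pselect (exists w, path_mul p w = Some v) is left pv
           then x (projT1 (cid pv)) else 0.

Lemma left_mul_funE p x v w :
  path_mul p w = Some v -> left_mul_fun p x v = x w.
Proof.
move=> pwv; rewrite /left_mul_fun; case: pselect => [pv|[]]; last by exists w.
by congr x; apply: path_mul_inj pwv; case: (cid pv).
Qed.

Lemma left_mul_fun0 p x v :
  (forall w, path_mul p w <> Some v) -> left_mul_fun p x v = 0.
Proof.
move=> nv; rewrite /left_mul_fun; case: pselect => // pv.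
by have [w /nv] := pv.
Qed.

Lemma esum_left_mul p (x : dipath G -> C) :
  (\esum_(v in [set: dipath G]) (normc (left_mul_fun p x v) ^+ 2)%:E <=
   \esum_(w in [set: dipath G]) (normc (x w) ^+ 2)%:E)%E.
Proof.
pose D := [set w | exists v, path_mul p w = Some v].
pose m w := odflt w (path_mul p w).
have mD w : D w -> path_mul p w = Some (m w).
  by move=> [v wv]; rewrite /m wv.
have Dinj : set_inj D m.
  move=> w w' /set_mem Dw /set_mem Dw' ww'; apply: (@path_mul_inj _ p _ _ (m w)).
    exact: mD.
  by rewrite ww'; exact: mD.
have -> : (\esum_(v in [set: dipath G]) (normc (left_mul_fun p x v) ^+ 2)%:E =
    \esum_(v in m @` D) (normc (left_mul_fun p x v) ^+ 2)%:E)%E.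
  rewrite [RHS]esum_mkcond; apply: eq_esum => v _.
  case: ifPn => // /negP nv; rewrite left_mul_fun0 ?normc0 ?expr0n// => w wv.
  by apply: nv; apply/mem_set; exists w; [exists v|rewrite /m wv].
rewrite esum_image// esum_mkcond; apply: le_esum => w _.
case: ifPn => [/set_mem Dw|_]; last by rewrite lee_fin sqr_ge0.
by rewrite (left_mul_funE _ (mD _ Dw)).
Qed.

Lemma left_mul_subproof p (x : H) :
  left_mul_fun p x \in @square_summable_pred R _.
Proof.
apply/square_summableP; apply: le_lt_trans (esum_left_mul p x) _.
exact/square_summableP/ell2P.
Qed.

(* The operator L_p, see [left_mul_basis]. *)
Definition left_mul (p : dipath G) (x : H) : H := Ell2 (left_mul_subproof p x).

Lemma left_mul_basis p w :
  left_mul p (basis R w) = if path_mul p w is Some v then basis R v else 0.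
Proof.
apply: val_inj; apply/funext => u /=.
have [[w' w'u]|nu] := pselect (exists w', path_mul p w' = Some u).
  rewrite (left_mul_funE _ w'u) /=; case wv: path_mul => [v|] /=.
    congr (_%:R); congr nat_of_bool; apply/eqP/eqP => [w'w|uv].
      by move: w'u; rewrite w'w wv => -[].
    by apply: path_mul_inj w'u _; rewrite uv.
  by case: eqVneq => // w'w; rewrite w'w wv in w'u.
rewrite left_mul_fun0; last by move=> w' w'u; apply: nu; exists w'.
case wv: path_mul => [v|] //=.
by case: eqVneq => // uv; case: nu; exists w; rewrite uv.
Qed.

Lemma left_mul_bounded p : bounded_operator (left_mul p).
Proof.
split.
  move=> a x y; apply: val_inj; apply/funext => u.
  change (left_mul_fun p (a *: x + y) u =
    a * left_mul_fun p x u + left_mul_fun p y u).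
  have [[w wu]|nu] := pselect (exists w, path_mul p w = Some u).
    by rewrite !(left_mul_funE _ wu).
  have nu' w : path_mul p w <> Some u by move=> wu; apply: nu; exists w.
  by rewrite !left_mul_fun0// mulr0 addr0.
exists 1 => x; rewrite mul1r ler_wsqrtr//.
apply: fine_le; last exact: esum_left_mul.
  rewrite ge0_fin_numE; last by apply: esum_ge0 => i _; rewrite lee_fin sqr_ge0.
  exact/square_summableP/left_mul_subproof.
rewrite ge0_fin_numE; last by apply: esum_ge0 => i _; rewrite lee_fin sqr_ge0.
exact/square_summableP/ell2P.
Qed.

(* WOT closure of the (non-unital) algebra generated by the L_p. *)
Definition free_semigroupoid_algebra : set (H -> H) :=
  wot_closure (smallest (@subalgebra _ H) [set left_mul p | p in [set: dipath G]]).

End FreeSemigroupoidAlgebra.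

Arguments free_semigroupoid_algebra : clear implicits.

(* Main.v *)
From Stdlib Require Import Relation_Operators.
From mathcomp Require Import all_boot all_order all_algebra.
From mathcomp Require Import all_classical all_reals all_analysis.
From mathcomp Require Import complex zify ring lra.
Require Import Defs.

(** Write A for the algebra, L_p for its generators, a_u for the Fourier
    coefficients of a in A, and say that a path u returns if some path leads
    from its range back to its source.  Both radicals of A are compared with the
    ideal J of the elements whose coefficients vanish at all the paths that
    return.

    Both radicals are contained in J ([radical_return_coef]).  The coefficient
    at a vertex is a character of A.  A path of positive length that returns is
    an initial part of a closed walk, and going round that walk for ever gives a
    periodic walk, with a minimal period k and with initial parts u_0, u_1, ....
    For 0 < t <= 1/2 the vectors zeta_j, the sum of t^n xi_(u_n) over n congruent
    to j modulo k, span a space that is invariant under the adjoint of each L_p,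
    since the adjoint cuts off the last edges of a path
    ([inner_left_mul_zeta]).  So A acts on a quotient of H of dimension k, and
    as the period is minimal a window of length at least k determines its place
    in the walk, whence A acts by all the k x k matrices.
    The k x k matrices form a simple ring, acting on a simple module: the kernel
    of the action is a maximal ideal, and an intersection of maximal left ideals
    ([strong_radical_matrix_units], [jacobson_radical_matrix_units]).  Hence an
    element a of either radical acts by 0.  This says that the power series in t
    with coefficients a_(u_n), for n in a fixed residue class, vanishes for all
    small t; thus all a_(u_n) are 0 ([orthogonal_zeta_coef]).

    Conversely a nilpotent ideal of a unital algebra lies in both radicals
    ([nil_ideal_jacobson], [nil_ideal_strong_radical]).  If there are finitely
    many vertices then J is nilpotent, because a path that does not return
    leaves a strongly connected component for good; so both radicals are J.
    For arbitrary G, if an edge e does not return then no path contains e twice,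
    and L_e lies in an ideal of square 0 ([acyclic_edge_radicals]).  If every
    edge returns then every path does, and J is 0 ([no_return_ideal0]).  That
    every edge returns is transitivity in each component
    ([transitive_in_each_componentP]), and the equivalences follow.

    The elements of A enter only through relations <T x, y> = <T x', y'> that
    hold for the generators and pass to the closure ([fsa_agree_on]).  In this
    way (T x)(v) depends only on the values of x at the initial segments of v
    ([fsa_local]), and T commutes with the multiplications on the right
    ([fsa_right_mul]).  That A is an algebra uses adjoints
    ([wot_closure_subalgebra]); it is unital because the finite sums of the
    projections attached to the vertices converge to the identity ([fsa_id]). *)

Set Implicit Arguments.
Unset Strict Implicit.
Unset Printing Implicit Defensive.

Import Order.TTheory GRing.Theory Num.Theory.
Import numFieldNormedType.Exports Normc.
Local Open Scope classical_set_scope.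
Local Open Scope ring_scope.
Local Open Scope complex_scope.

(** * Linear maps *)

Section LinearMaps.
Variables (K : pzRingType) (V : lmodType K) (T : V -> V).
Hypothesis lT : linear T.

Lemma linear_map0 : T 0 = 0.
Proof.
have := lT 1 0 0; rewrite !scale1r !addr0 => E.
apply: (addrI (T 0)).
by rewrite addr0 -E.
Qed.

Lemma linear_mapD x y : T (x + y) = T x + T y.
Proof. by have := lT 1 x y; rewrite !scale1r. Qed.

Lemma linear_mapZ (k : K) x : T (k *: x) = k *: T x.
Proof. by have := lT k x 0; rewrite linear_map0 !addr0. Qed.

Lemma linear_mapB x y : T (x - y) = T x - T y.
Proof. by rewrite linear_mapD -scaleN1r linear_mapZ scaleN1r. Qed.

Lemma linear_map_sum (J : Type) (r : seq J) (f : J -> V) :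
  T (\sum_(j <- r) f j) = \sum_(j <- r) T (f j).
Proof.
elim: r => [|j r IHr]; first by rewrite !big_nil linear_map0.
by rewrite !big_cons linear_mapD IHr.
Qed.

End LinearMaps.

(** * Unconditional sums of real families *)

Section UnconditionalSums.
Variables (R : realType) (I : choiceType).
Implicit Types (f g : I -> R) (F : seq I).

(** Convergence along the directed set of finite subsets.  Linearity is
    immediate in this form, whereas [real_sum] is a difference of two suprema. *)
Definition has_real_sum f (s : R) : Prop :=
  forall e : R, 0 < e -> exists F0, forall F, uniq F -> {subset F0 <= F} ->
    `|\sum_(i <- F) f i - s| < e.

Lemma has_real_sum_uniq f s t : has_real_sum f s -> has_real_sum f t -> s = t.
Proof.
move=> fs ft; apply/eqP; rewrite -subr_eq0 -normr_eq0; apply/eqP/le_anti.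
rewrite normr_ge0 andbT; apply/ler_addgt0Pr => e e0; rewrite add0r.
have [F1 H1] := fs (e / 2) (divr_gt0 e0 (ltr0Sn _ _)).
have [F2 H2] := ft (e / 2) (divr_gt0 e0 (ltr0Sn _ _)).
have U := undup_uniq (F1 ++ F2).
have {}H1 := H1 _ U _; have {}H2 := H2 _ U _.
have : `|\sum_(i <- undup (F1 ++ F2)) f i - s| < e / 2.
  by apply: H1 => i iF; rewrite mem_undup mem_cat iF.
have : `|\sum_(i <- undup (F1 ++ F2)) f i - t| < e / 2.
  by apply: H2 => i iF; rewrite mem_undup mem_cat iF orbT.
move: (\sum_(i <- _) _) => u.
by rewrite ltr_norml => /andP[? ?]; rewrite ltr_norml => /andP[? ?]; rewrite ler_norml; lra.
Qed.

Lemma has_real_sumD f g s t :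
  has_real_sum f s -> has_real_sum g t -> has_real_sum (fun i => f i + g i) (s + t).
Proof.
move=> fs gt e e0.
have [F1 H1] := fs (e / 2) (divr_gt0 e0 (ltr0Sn _ _)).
have [F2 H2] := gt (e / 2) (divr_gt0 e0 (ltr0Sn _ _)).
exists (F1 ++ F2) => F U S.
have {}H1 : `|\sum_(i <- F) f i - s| < e / 2.
  by apply: H1 => // i iF; apply: S; rewrite mem_cat iF.
have {}H2 : `|\sum_(i <- F) g i - t| < e / 2.
  by apply: H2 => // i iF; apply: S; rewrite mem_cat iF orbT.
rewrite big_split /=; apply: le_lt_trans (_ : _ <= `|\sum_(i <- F) f i - s| + `|\sum_(i <- F) g i - t|) _.
  by rewrite opprD addrACA ler_normD.
lra.
Qed.

Lemma has_real_sumZ f s (k : R) :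
  has_real_sum f s -> has_real_sum (fun i => k * f i) (k * s).
Proof.
move=> fs e e0; have k1 : 0 < `|k| + 1 by rewrite ltr_wpDl.
have [F0 H0] := fs (e / (`|k| + 1)) (divr_gt0 e0 k1).
exists F0 => F U S; rewrite -mulr_sumr -mulrBr normrM.
have := H0 F U S; rewrite ltr_pdivlMr//; apply: le_lt_trans.
by rewrite mulrC ler_wpM2l// lerDl.
Qed.

Lemma has_real_sum1 f i : (forall j, j != i -> f j = 0) -> has_real_sum f (f i).
Proof.
move=> fi e e0; exists [:: i] => F U S.
rewrite (bigD1_seq i)//=; last by apply: S; rewrite mem_head.
by rewrite big1 ?addr0 ?subrr ?normr0// => j _.
Qed.

Lemma has_real_sum_norm_le f s B : has_real_sum f s ->
  (forall F, uniq F -> `|\sum_(i <- F) f i| <= B) -> `|s| <= B.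
Proof.
move=> fs fB; apply/ler_addgt0Pr => e e0.
have [F0 H0] := fs e e0.
have B1 := fB _ (undup_uniq F0).
have B2 : `|\sum_(i <- undup F0) f i - s| < e.
  by apply: H0 (undup_uniq F0) _ => i; rewrite mem_undup.
rewrite -[s](subKr (\sum_(i <- undup F0) f i)).
apply: le_trans (ler_normB _ _) _; exact: lerD B1 (ltW B2).
Qed.

Lemma sum_subset_le f F F' : (forall i, 0 <= f i) -> uniq F -> uniq F' ->
  {subset F <= F'} -> \sum_(i <- F) f i <= \sum_(i <- F') f i.
Proof.
move=> f0 U U' S; rewrite [leRHS](bigID (fun i => i \in F))/= -[leLHS]addr0.
rewrite lerD ?sumr_ge0// -[leRHS]big_filter [leRHS](perm_big F)//=.
apply: uniq_perm => //; first exact: filter_uniq.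
by move=> i; rewrite mem_filter; case: (boolP (i \in F)) => //= /S.
Qed.

Lemma sum_le_esum f F : (forall i, 0 <= f i) -> uniq F ->
  ((\sum_(i <- F) f i)%:E <= \esum_(i in [set: I]) (f i)%:E)%E.
Proof.
move=> f0 U; apply: esum_ge; exists [set` F]; first by split => //; exact: finite_seq.
by rewrite -fsbig_seq//= sumEFin.
Qed.

Lemma esum_le_sum f B : (forall F, uniq F -> \sum_(i <- F) f i <= B) ->
  (\esum_(i in [set: I]) (f i)%:E <= B%:E)%E.
Proof.
move=> fB; apply: ge_ereal_sup => _ [A [finA _] <-].
by rewrite fsbig_finite//= sumEFin lee_fin fB// finmap.fset_uniq.
Qed.

Lemma has_real_sum_esum f : (forall i, 0 <= f i) ->
  (\esum_(i in [set: I]) (f i)%:E < +oo)%E ->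
  has_real_sum f (fine (\esum_(i in [set: I]) (f i)%:E)).
Proof.
move=> f0 foo e e0.
have fin : \esum_(i in [set: I]) (f i)%:E \is a fin_num.
  by rewrite ge0_fin_numE//; apply: esum_ge0 => i _; rewrite lee_fin.
have [_ [A [finA _] <-]] := ub_ereal_sup_adherent e0 fin.
rewrite fsbig_finite//= sumEFin => Ae.
move: Ae; set F0 := finmap.enum_fset _ => Ae; exists F0 => F U S.
have /esym E := fineK fin; set s := fine _ in E *.
have {}Ae : s - e < \sum_(i <- F0) f i by rewrite -lte_fin EFinB -E.
have sF : \sum_(i <- F) f i <= s by rewrite -lee_fin -E; exact: sum_le_esum.
have F0F : \sum_(i <- F0) f i <= \sum_(i <- F) f i.
  by apply: sum_subset_le => //; exact: finmap.fset_uniq.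
by rewrite ltr_norml; lra.
Qed.

Lemma has_real_sum_real_sum f B : (forall F, uniq F -> \sum_(i <- F) `|f i| <= B) ->
  has_real_sum f (real_sum f).
Proof.
move=> fB; rewrite /real_sum.
have P : (fun i => ((EFin \o f)^\+ i)%E) = (fun i => (Num.max (f i) 0)%:E).
  by apply/funext => i; rewrite funeposE/= EFin_max.
have N : (fun i => ((EFin \o f)^\- i)%E) = (fun i => (Num.max (- f i) 0)%:E).
  by apply/funext => i; rewrite funenegE/= EFin_max.
rewrite P N.
have p0 i : 0 <= Num.max (f i) 0 by rewrite le_max lexx orbT.
have n0 i : 0 <= Num.max (- f i) 0 by rewrite le_max lexx orbT.
have poo : (\esum_(i in [set: I]) (Num.max (f i) 0)%:E <= B%:E)%E.
  apply: esum_le_sum => F U; apply: le_trans (fB F U); apply: ler_sum => i _.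
  by rewrite ge_max ler_norm normr_ge0.
have noo : (\esum_(i in [set: I]) (Num.max (- f i) 0)%:E <= B%:E)%E.
  apply: esum_le_sum => F U; apply: le_trans (fB F U); apply: ler_sum => i _.
  by rewrite ge_max -normrN ler_norm normr_ge0.
have {}poo := le_lt_trans poo (ltry B).
have {}noo := le_lt_trans noo (ltry B).
have := has_real_sumD (has_real_sum_esum p0 poo) (has_real_sumZ (-1) (has_real_sum_esum n0 noo)).
have -> : (fun i => Num.max (f i) 0 + (-1) * Num.max (- f i) 0) = f.
  apply/funext => i; rewrite mulN1r.
  have [f0|f0] := leP 0 (f i).
    by rewrite (max_idPr _) ?oppr_le0// subr0.
  by rewrite (max_idPl _) ?oppr_ge0 ?(ltW f0)// add0r opprK.
rewrite mulN1r fineB// ge0_fin_numE//; apply: esum_ge0 => i _; by rewrite lee_fin.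
Qed.

End UnconditionalSums.

(** * The inner product *)

Section Ell2Theory.
Variables (R : realType) (I : choiceType).
Local Notation C := R[i].
Local Notation H := (ell2 R I).
Implicit Types (x y z : H) (F : seq I).

Definition ell2_sqnorm x : R :=
  fine (\esum_(i in [set: I]) (normc (x i) ^+ 2)%:E)%E.
Local Notation nsq := ell2_sqnorm.

Lemma ell2_has_real_sum x : has_real_sum (fun i => normc (x i) ^+ 2) (nsq x).
Proof.
apply: has_real_sum_esum => [i|]; first exact: sqr_ge0.
exact/square_summableP/ell2P.
Qed.

Lemma ell2_sum_le x F : uniq F -> \sum_(i <- F) normc (x i) ^+ 2 <= nsq x.
Proof.
move=> U; rewrite -lee_fin /ell2_sqnorm fineK.
  by apply: sum_le_esum => // i; exact: sqr_ge0.
rewrite ge0_fin_numE; first exact/square_summableP/ell2P.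
by apply: esum_ge0 => i _; rewrite lee_fin sqr_ge0.
Qed.

Lemma ell2_sqnorm_ge0 x : 0 <= nsq x.
Proof. by have := @ell2_sum_le x [::] isT; rewrite big_nil. Qed.

Lemma ell2_sqnorm_le x B :
  (forall F, uniq F -> \sum_(i <- F) normc (x i) ^+ 2 <= B) -> nsq x <= B.
Proof.
move=> xB; have /esum_le_sum := xB.
rewrite -[X in (X <= _)%E]fineK ?lee_fin// ge0_fin_numE.
  exact/square_summableP/ell2P.
by apply: esum_ge0 => i _; rewrite lee_fin sqr_ge0.
Qed.

Lemma square_summable_bound (f : I -> C) B :
  (forall F, uniq F -> \sum_(i <- F) normc (f i) ^+ 2 <= B) ->
  f \in @square_summable_pred R I.
Proof.
move=> fB; apply/square_summableP/(le_lt_trans _ (ltry B)).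
exact: esum_le_sum.
Qed.

Lemma ell2_normE x : ell2_norm x = Num.sqrt (nsq x). Proof. by []. Qed.

Lemma ell2P_ext x y : (forall i, x i = y i) -> x = y.
Proof. by move=> xy; apply: val_inj; apply/funext. Qed.

Lemma ell2D x y i : (x + y) i = x i + y i. Proof. by []. Qed.
Lemma ell2Z (k : C) x i : (k *: x) i = k * x i. Proof. by []. Qed.
Lemma ell2N x i : (- x) i = - x i. Proof. by []. Qed.
Lemma ell20 i : (0 : H) i = 0. Proof. by []. Qed.
Lemma ell2_sum (J : Type) (r : seq J) (f : J -> H) i :
  (\sum_(j <- r) f j) i = \sum_(j <- r) f j i.
Proof. by elim/big_rec2: _ => // j a b _ <-. Qed.

Lemma normc_ge0 (z : C) : 0 <= normc z.
Proof. by case: z => a b /=; exact: sqrtr_ge0. Qed.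

Lemma normc_conj (z : C) : normc z^* = normc z.
Proof. by case: z => a b /=; rewrite sqrrN. Qed.

Lemma Re_le_normc (z : C) : `|complex.Re z| <= normc z.
Proof. by case: z => a b /=; rewrite -sqrtr_sqr ler_wsqrtr// lerDl sqr_ge0. Qed.

Lemma Im_le_normc (z : C) : `|complex.Im z| <= normc z.
Proof. by case: z => a b /=; rewrite -sqrtr_sqr ler_wsqrtr// lerDr sqr_ge0. Qed.

Lemma normc_le_ReIm (z : C) : normc z <= `|complex.Re z| + `|complex.Im z|.
Proof.
case: z => a b /=; rewrite -[leRHS]ger0_norm ?addr_ge0// -sqrtr_sqr ler_wsqrtr//.
rewrite sqrrD !real_normK ?num_real//.
have := mulr_ge0 (normr_ge0 a) (normr_ge0 b).
by rewrite mulr2n; lra.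
Qed.

Lemma weighted_young (e : R) (a b : C) : 0 < e ->
  2 * normc (a * b^*) <= e * normc a ^+ 2 + normc b ^+ 2 / e.
Proof.
move=> e0; rewrite normcM normc_conj -subr_ge0.
have -> : e * normc a ^+ 2 + normc b ^+ 2 / e - 2 * (normc a * normc b) =
   (e * normc a - normc b) ^+ 2 / e by field; rewrite gt_eqF.
by rewrite divr_ge0 ?sqr_ge0// ltW.
Qed.

Lemma sum_normc_young (e : R) x y F : 0 < e -> uniq F ->
  2 * \sum_(i <- F) normc (x i * (y i)^*) <= e * nsq x + nsq y / e.
Proof.
move=> e0 U; rewrite mulr_sumr.
apply: le_trans (ler_sum _ (fun i _ => weighted_young (x i) (y i) e0)) _.
rewrite big_split/= -mulr_sumr -mulr_suml lerD//.
  by rewrite ler_pM2l// ell2_sum_le.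
by rewrite ler_pM2r ?invr_gt0// ell2_sum_le.
Qed.

Lemma inner_has_real_sum x y :
  has_real_sum (fun i => complex.Re (x i * (y i)^*)) (complex.Re (inner x y)) /\
  has_real_sum (fun i => complex.Im (x i * (y i)^*)) (complex.Im (inner x y)).
Proof.
have B F : uniq F -> \sum_(i <- F) normc (x i * (y i)^*) <= nsq x + nsq y.
  move=> U; have := sum_normc_young x y ltr01 U.
  have : 0 <= \sum_(i <- F) normc (x i * (y i)^*).
    by apply: sumr_ge0 => i _; exact: normc_ge0.
  by lra.
split; apply: (@has_real_sum_real_sum _ _ _ (nsq x + nsq y)) => F U;
  apply: le_trans (B F U); apply: ler_sum => i _.
  exact: Re_le_normc.
exact: Im_le_normc.
Qed.

Lemma inner_unique x y s :
  has_real_sum (fun i => complex.Re (x i * (y i)^*)) (complex.Re s) ->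
  has_real_sum (fun i => complex.Im (x i * (y i)^*)) (complex.Im s) ->
  inner x y = s.
Proof.
have [Hr Hi] := inner_has_real_sum x y => /(has_real_sum_uniq Hr) + /(has_real_sum_uniq Hi).
by case: (inner x y) s => a b [c d] /= -> ->.
Qed.

Lemma inner_linearl (k : C) x z y :
  inner (k *: x + z) y = k * inner x y + inner z y.
Proof.
have [xr xi] := inner_has_real_sum x y; have [zr zi] := inner_has_real_sum z y.
apply: inner_unique.
  have := has_real_sumD (has_real_sumD (has_real_sumZ (complex.Re k) xr)
    (has_real_sumZ (- complex.Im k) xi)) zr.
  congr (has_real_sum _ _); first apply/funext => i; rewrite ?ell2D ?ell2Z.
    by case: k (x i) (z i) (y i) => [? ?] [? ?] [? ?] [? ?] /=; ring.
  by case: k (inner x y) (inner z y) => [? ?] [? ?] [? ?] /=; ring.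
have := has_real_sumD (has_real_sumD (has_real_sumZ (complex.Re k) xi)
  (has_real_sumZ (complex.Im k) xr)) zi.
congr (has_real_sum _ _); first apply/funext => i; rewrite ?ell2D ?ell2Z.
  by case: k (x i) (z i) (y i) => [? ?] [? ?] [? ?] [? ?] /=; ring.
by case: k (inner x y) (inner z y) => [? ?] [? ?] [? ?] /=; ring.
Qed.

Lemma innerDl x z y : inner (x + z) y = inner x y + inner z y.
Proof. by have := inner_linearl 1 x z y; rewrite scale1r mul1r. Qed.

Lemma inner0l y : inner (0 : H) y = 0.
Proof. by apply: (addrI (inner 0 y)); rewrite -innerDl !addr0. Qed.

Lemma innerZl (k : C) x y : inner (k *: x) y = k * inner x y.
Proof. by have := inner_linearl k x 0 y; rewrite !addr0 inner0l addr0. Qed.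

Lemma innerNl x y : inner (- x) y = - inner x y.
Proof. by rewrite -scaleN1r innerZl mulN1r. Qed.

Lemma innerBl x z y : inner (x - z) y = inner x y - inner z y.
Proof. by rewrite innerDl innerNl. Qed.

Lemma inner_suml (J : Type) (r : seq J) (f : J -> H) y :
  inner (\sum_(j <- r) f j) y = \sum_(j <- r) inner (f j) y.
Proof.
elim: r => [|j r IHr]; first by rewrite !big_nil inner0l.
by rewrite !big_cons innerDl IHr.
Qed.

Lemma inner_single x y i : (forall j, j != i -> x j * (y j)^* = 0) ->
  inner x y = x i * (y i)^*.
Proof.
by move=> xy; apply: inner_unique; apply: has_real_sum1 => j /xy ->.
Qed.

Lemma inner_conj x y : inner y x = (inner x y)^*.
Proof.
have [xr xi] := inner_has_real_sum x y; apply: inner_unique.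
  have := xr; congr (has_real_sum _ _); first apply/funext => i.
    by case: (x i) (y i) => [? ?] [? ?] /=; ring.
have := has_real_sumZ (-1) xi; congr (has_real_sum _ _); first apply/funext => i.
  by case: (x i) (y i) => [? ?] [? ?] /=; ring.
by case: (inner x y) => a b /=; rewrite mulN1r.
Qed.

Lemma inner0r x : inner x (0 : H) = 0.
Proof. by rewrite inner_conj inner0l conjc0. Qed.

Lemma innerDr x y z : inner x (y + z) = inner x y + inner x z.
Proof.
rewrite inner_conj innerDl [inner x y]inner_conj [inner x z]inner_conj.
exact: rmorphD.
Qed.

Lemma inner_real_scaler (k : R) x y : inner x (k%:C *: y) = k%:C * inner x y.
Proof.
rewrite inner_conj innerZl [inner x y]inner_conj.
by case: (inner y x) => a b; simpc; congr (_ +i* _); ring.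
Qed.

Lemma eq_innerr x y z : (forall i, x i != 0 -> y i = z i) -> inner x y = inner x z.
Proof.
move=> yz; congr complex_sum; apply/funext => i.
by have [->|/yz ->] := eqVneq (x i) 0; rewrite ?mul0r.
Qed.

Lemma basisE (i j : I) : basis R i j = (j == i)%:R. Proof. by []. Qed.

Lemma inner_basisr x (i : I) : inner x (basis R i) = x i.
Proof.
rewrite (@inner_single _ _ i) => [|j /negPf ji]; rewrite basisE.
  by rewrite eqxx rmorph_nat; exact: mulr1.
by rewrite ji rmorph_nat; exact: mulr0.
Qed.

Lemma inner_basisl y (i : I) : inner (basis R i) y = (y i)^*.
Proof.
rewrite (@inner_single _ _ i) => [|j /negPf ji]; rewrite basisE.
  by rewrite eqxx; exact: mul1r.
by rewrite ji; exact: mul0r.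
Qed.

(** Serves as the Cauchy-Schwarz inequality: every continuity argument below
    adjusts the weight e instead of taking square roots. *)
Lemma inner_young (e : R) x y : 0 < e ->
  normc (inner x y) <= e * nsq x + nsq y / e.
Proof.
move=> e0; have [xr xi] := inner_has_real_sum x y.
pose B := (e * nsq x + nsq y / e) / 2.
have SB F : uniq F -> normc (\sum_(i <- F) x i * (y i)^*) <= B.
  move=> U; rewrite /B ler_pdivlMr// mulrC.
  apply: le_trans (sum_normc_young x y e0 U); rewrite ler_pM2l//.
  elim/big_rec2: _ => [|i a b _ ab]; first by rewrite normc0.
  by apply: le_trans (le_normcD _ _) _; rewrite lerD2l.
have Er F : \sum_(i <- F) complex.Re (x i * (y i)^*) =
    complex.Re (\sum_(i <- F) x i * (y i)^*).
  by symmetry; apply: big_morph => // -[? ?] [? ?].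
have Ei F : \sum_(i <- F) complex.Im (x i * (y i)^*) =
    complex.Im (\sum_(i <- F) x i * (y i)^*).
  by symmetry; apply: big_morph => // -[? ?] [? ?].
apply: le_trans (normc_le_ReIm _) _.
have : `|complex.Re (inner x y)| <= B.
  apply: has_real_sum_norm_le xr _ => F U; rewrite Er; exact: le_trans (Re_le_normc _) (SB F U).
have : `|complex.Im (inner x y)| <= B.
  apply: has_real_sum_norm_le xi _ => F U; rewrite Ei; exact: le_trans (Im_le_normc _) (SB F U).
by rewrite /B; lra.
Qed.

Definition finite_comb F (c : I -> C) : H := \sum_(i <- F) c i *: basis R i.

Lemma finite_combE F (c : I -> C) i :
  uniq F -> finite_comb F c i = if i \in F then c i else 0.
Proof.
move=> U; rewrite /finite_comb ell2_sum; case: ifPn => iF.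
  rewrite (bigD1_seq i iF U) ell2Z basisE eqxx mulr1 big1 => [|j ji].
    exact: addr0.
  by rewrite ell2Z basisE eq_sym (negPf ji) mulr0.
rewrite big_seq big1// => j jF; rewrite ell2Z basisE.
by case: eqP iF => [->|_]; rewrite ?jF //; rewrite mulr0.
Qed.

Lemma finite_comb_sqnorm_le F (c : I -> C) : uniq F ->
  nsq (finite_comb F c) <= \sum_(i <- F) normc (c i) ^+ 2.
Proof.
move=> U; apply: ell2_sqnorm_le => F' U'.
have -> : \sum_(i <- F') normc (finite_comb F c i) ^+ 2 =
    \sum_(i <- [seq i <- F' | i \in F]) normc (c i) ^+ 2.
  rewrite big_filter [RHS]big_mkcond; apply: eq_bigr => i _.
  by rewrite finite_combE//; case: ifP => // _; rewrite normc0 expr0n.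
apply: sum_subset_le => //; first by move=> i; exact: sqr_ge0.
  exact: filter_uniq.
by move=> i; rewrite mem_filter => /andP[].
Qed.

Lemma finite_comb_approx x (e : R) : 0 < e ->
  exists F, uniq F /\ nsq (x - finite_comb F x) <= e.
Proof.
move=> e0; have [F0 H0] := ell2_has_real_sum x e0.
pose F := undup F0; have U : uniq F by exact: undup_uniq.
exists F; split => //; apply: ell2_sqnorm_le => F' U'.
have := H0 F U (fun i iF => _); rewrite /F.
have -> : \sum_(i <- F') normc ((x - finite_comb F x) i) ^+ 2 =
    \sum_(i <- [seq i <- F' | i \notin F]) normc (x i) ^+ 2.
  rewrite big_filter [RHS]big_mkcond; apply: eq_bigr => i _.
  rewrite ell2D ell2N finite_combE//; case: ifP => _ /=.
    by rewrite subrr normc0 expr0n.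
  by rewrite subr0.
have UU : uniq ([seq i <- F' | i \notin F] ++ F).
  rewrite cat_uniq filter_uniq// U andbT/=; apply/hasPn => i iF.
  by rewrite mem_filter iF.
have := ell2_sum_le x UU; rewrite big_cat/=.
have {}H0 : `|\sum_(i <- F) normc (x i) ^+ 2 - nsq x| < e.
  by apply: H0 => // i; rewrite mem_undup.
by move: H0; rewrite ltr_norml => /andP[? ?] ? _; lra.
Qed.

End Ell2Theory.

(** * Adjoints and closures in the weak operator topology *)

Section BoundedOperators.
Variables (R : realType) (I : choiceType).
Local Notation C := R[i].
Local Notation H := (ell2 R I).
Local Notation nsq := (@ell2_sqnorm R I).
Implicit Types (S T : H -> H) (x y z : H).


Lemma bounded_operatorP T : bounded_operator T <->
  linear T /\ exists2 K : R, 0 < K & forall x, nsq (T x) <= K * nsq x.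
Proof.
split=> -[lT]; [move=> [M TM]|move=> [K K0 TK]]; split => //.
  exists (M ^+ 2 + 1) => [|x]; first by rewrite ltr_wpDl ?sqr_ge0.
  apply: le_trans (_ : _ <= M ^+ 2 * nsq x) _; last first.
    by rewrite ler_wpM2r ?ell2_sqnorm_ge0// lerDl.
  have := TM x; rewrite !ell2_normE => TMx.
  rewrite -[leLHS]sqr_sqrtr ?ell2_sqnorm_ge0//.
  rewrite -[nsq x]sqr_sqrtr ?ell2_sqnorm_ge0// -exprMn.
  by rewrite ler_sqr ?nnegrE ?sqrtr_ge0// (le_trans _ TMx) ?sqrtr_ge0.
exists (Num.sqrt K) => x; rewrite !ell2_normE -sqrtrM ?(ltW K0)//.
by rewrite ler_wsqrtr.
Qed.

Lemma bounded0 : bounded_operator (0 : H -> H).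
Proof.
apply/bounded_operatorP; split=> [k x y|]; first by rewrite /= scaler0 addr0.
exists 1 => // x; apply: ell2_sqnorm_le => F _; rewrite mul1r big1 ?ell2_sqnorm_ge0//.
by move=> i _; rewrite normc0 expr0n.
Qed.

Lemma sqnormZ (k : C) x : nsq (k *: x) <= normc k ^+ 2 * nsq x.
Proof.
apply: ell2_sqnorm_le => F U.
under eq_bigr do rewrite ell2Z normcM exprMn.
by rewrite -mulr_sumr ler_wpM2l ?sqr_ge0// ell2_sum_le.
Qed.

Lemma sqnormD x y : nsq (x + y) <= 2 * nsq x + 2 * nsq y.
Proof.
apply: ell2_sqnorm_le => F U.
apply: le_trans (ler_sum _ (fun i _ => normcD_sqr (x i) (y i))) _.
rewrite big_split/= -!mulr_sumr lerD// ler_wpM2l// ell2_sum_le//.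
Qed.

Lemma operatorD S T x : (S + T) x = S x + T x. Proof. by []. Qed.
Lemma operatorZ (k : C) T x : (k *: T) x = k *: T x. Proof. by []. Qed.

Lemma boundedD S T :
  bounded_operator S -> bounded_operator T -> bounded_operator (S + T).
Proof.
move=> /bounded_operatorP[lS [K K0 SK]] /bounded_operatorP[lT [L L0 TL]].
apply/bounded_operatorP; split=> [k x y|].
  by rewrite !operatorD lS lT scalerDr addrACA.
exists (2 * K + 2 * L) => [|x]; first by rewrite addr_gt0// mulr_gt0.
apply: le_trans (sqnormD _ _) _; rewrite [leRHS]mulrDl -!mulrA.
by rewrite lerD// ler_wpM2l.
Qed.

Lemma boundedZ (k : C) T : bounded_operator T -> bounded_operator (k *: T).
Proof.
move=> /bounded_operatorP[lT [L L0 TL]]; apply/bounded_operatorP.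
split=> [c x y|].
  by rewrite !operatorZ lT scalerDr !scalerA [k * c]mulrC.
exists ((normc k ^+ 2 + 1) * L) => [|x].
  by rewrite mulr_gt0// ltr_wpDl ?sqr_ge0.
apply: le_trans (sqnormZ _ _) _; rewrite -[leRHS]mulrA ler_pM// ?sqr_ge0 ?ell2_sqnorm_ge0//.
by rewrite lerDl.
Qed.

Lemma bounded_comp S T :
  bounded_operator S -> bounded_operator T -> bounded_operator (S \o T).
Proof.
move=> /bounded_operatorP[lS [K K0 SK]] /bounded_operatorP[lT [L L0 TL]].
apply/bounded_operatorP; split=> [k x y|]; first by rewrite /= lT lS.
exists (K * L) => [|x]; first exact: mulr_gt0.
by apply: le_trans (SK _) _; rewrite -mulrA ler_pM2l.
Qed.

(** Let c_i be the inner product of T xi_i with y, and let u be the sum of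
    c_i^* xi_i over i in F.  The sum S of the |c_i|^2 is <T u, y>, while |u|^2 is at
    most S; so the inequality of Young with a small weight bounds S by half of
    itself plus a multiple of |y|^2. *)
Lemma adjoint_subproof T y : bounded_operator T ->
  (fun i => (inner (T (basis R i)) y)^*) \in @square_summable_pred R I.
Proof.
move=> /bounded_operatorP[lT [K K0 TK]].
apply: (@square_summable_bound _ _ _ (4 * K * nsq y)) => F U.
set c := fun i => inner (T (basis R i)) y.
under eq_bigr do rewrite normc_conj -/(c _).
set S := \sum_(i <- F) _.
have S0 : 0 <= S by apply: sumr_ge0 => i _; exact: sqr_ge0.
pose u := finite_comb F (fun i => (c i)^*).
have uS : nsq u <= S.
  apply: le_trans (finite_comb_sqnorm_le _ U) _.
  by apply: ler_sum => i _; rewrite normc_conj.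
have Tu : inner (T u) y = S%:C.
  rewrite /u /finite_comb (linear_map_sum lT) inner_suml /S rmorph_sum.
  apply: eq_bigr => i _; rewrite (linear_mapZ lT) innerZl -/(c i).
  by case: (c i) => a b; rewrite /= sqr_sqrtr ?addr_ge0 ?sqr_ge0//; simpc; congr (_ +i* _); ring.
have K2 : 0 < 2 * K by rewrite mulr_gt0.
have e0 : 0 < (2 * K)^-1 by rewrite invr_gt0.
have := inner_young (T u) y e0.
rewrite Tu /= expr0n /= addr0 sqrtr_sqr ger0_norm// invrK.
have : (2 * K)^-1 * nsq (T u) <= S / 2.
  rewrite invfM -mulrA [leRHS]mulrC ler_pM2l ?invr_gt0//.
  by rewrite ler_pdivrMl//; apply: le_trans (TK u) _; rewrite ler_pM2l.
by move: (nsq y) => n; lra.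
Qed.

(** Both sides are continuous in x, and they agree on finite combinations of
    basis vectors by the choice of the coordinates of z. *)
Lemma adjoint_exists T y : bounded_operator T ->
  exists z, forall x, inner (T x) y = inner x z.
Proof.
move=> bT; exists (Ell2 (adjoint_subproof y bT)) => x.
set z := Ell2 _.
have [lT [K K0 TK]] := (bounded_operatorP _).1 bT.
suff : normc (inner (T x) y - inner x z) <= 0.
  move=> n0; apply/eqP; rewrite -subr_eq0; apply/eqP/eq0_normc/le_anti.
  by rewrite n0 normc_ge0.
apply/ler_addgt0Pr => e e0; rewrite add0r.
(* the difference of the two functionals is continuous at 0 *)
have small u d : 0 < d -> normc (inner (T u) y - inner u z) <=
    d * ((K + 1) * nsq u) + (nsq y + nsq z) / d.
  move=> d0; apply: le_trans (le_normcD _ _) _; rewrite normcN.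
  apply: le_trans (lerD (inner_young _ _ d0) (inner_young _ _ d0)) _.
  have := ler_wpM2l (ltW d0) (TK u).
  rewrite [(nsq y + nsq z) / d]mulrDl [(K + 1) * _]mulrDl mul1r [d * (_ + _)]mulrDr.
  lra.
pose B := nsq y + nsq z + 1.
have B0 : 0 < B by rewrite ltr_wpDl// addr_ge0 ?ell2_sqnorm_ge0.
(* this weight makes the constant term at most e / 2 *)
pose d := 2 * B / e; have d0 : 0 < d by rewrite divr_gt0// mulr_gt0.
have K1 : 0 < K + 1 by rewrite ltr_wpDl// ltW.
have dK : 0 < 2 * d * (K + 1) by rewrite mulr_gt0// mulr_gt0//.
have h0 : 0 < e / (2 * d * (K + 1)) by rewrite divr_gt0.
have [F [U xF]] := finite_comb_approx x h0.
set xf := finite_comb F x in xF.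
have fin : inner (T xf) y = inner xf z.
  rewrite /xf /finite_comb (linear_map_sum lT) !inner_suml; apply: eq_bigr => i _.
  rewrite (linear_mapZ lT) !innerZl inner_basisl.
  have -> : z i = (inner (T (basis R i)) y)^* by [].
  by rewrite conjcK.
have -> : inner (T x) y - inner x z =
    inner (T (x - xf)) y - inner (x - xf) z.
  by rewrite (linear_mapB lT) !innerBl fin; ring.
apply: le_trans (small _ _ d0) _.
have h1 : d * ((K + 1) * nsq (x - xf)) <= e / 2.
  by have := xF; rewrite ler_pdivlMr//; lra.
have h2 : (nsq y + nsq z) / d <= e / 2.
  rewrite ler_pdivrMr// /d.
  have -> : e / 2 * (2 * B / e) = B by field; rewrite gt_eqF.
  by rewrite /B lerDl.
by rewrite [e]splitr lerD.
Qed.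

Lemma wot_closure_bounded (A : set (H -> H)) T : wot_closure A T -> bounded_operator T.
Proof. by case. Qed.

Lemma sub_wot_closure (A : set (H -> H)) :
  A `<=` @bounded_operator R I -> A `<=` wot_closure A.
Proof.
move=> bA T AT; apply/wot_closureP; split=> [|s e e0]; first exact: bA.
by exists T => // xy _; rewrite subrr normc0.
Qed.

Lemma wot_approx (A : set (H -> H)) T (s : seq (H * H)) (e : R) :
  wot_closure A T -> 0 < e -> exists2 S, A S &
    forall x y, (x, y) \in s -> normc (inner (T x) y - inner (S x) y) < e.
Proof.
move=> /wot_closureP[_ clT] e0; have [S AS ST] := clT s e e0.
by exists S => // x y xys; exact: (ST (x, y)).
Qed.

(** A linear relation between finitely many matrix coefficients is a closed
    condition. *)
Lemma wot_closure_sum_eq0 (A : set (H -> H)) T (s : seq (C * H * H)) :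
  wot_closure A T ->
  (forall S, A S -> \sum_(t <- s) t.1.1 * inner (S t.1.2) t.2 = 0) ->
  \sum_(t <- s) t.1.1 * inner (T t.1.2) t.2 = 0.
Proof.
move=> clT A0; apply/eq0_normc/le_anti; rewrite normc_ge0 andbT.
apply/ler_addgt0Pr => e e0; rewrite add0r.
pose B := \sum_(t <- s) normc t.1.1 + 1.
have B0 : 0 < B by rewrite ltr_wpDl// sumr_ge0// => t _; exact: normc_ge0.
have [S AS ST] := wot_approx [seq (t.1.2, t.2) | t <- s] clT (divr_gt0 e0 B0).
have -> : \sum_(t <- s) t.1.1 * inner (T t.1.2) t.2 = \sum_(t <- s)
    t.1.1 * (inner (T t.1.2) t.2 - inner (S t.1.2) t.2).
  under [RHS]eq_bigr do rewrite mulrBr.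
  by rewrite sumrB (A0 _ AS) subr0.
apply: le_trans (_ : _ <= \sum_(t <- s) normc t.1.1 * (e / B)) _.
  rewrite big_seq [leRHS]big_seq.
  elim/big_rec2: _ => [|t a b ts ab]; first by rewrite normc0.
  apply: le_trans (le_normcD _ _) _; rewrite lerD// normcM ler_wpM2l ?normc_ge0//.
  by apply/ltW/ST/mapP; exists t.
rewrite -mulr_suml mulrA ler_pdivrMr// mulrC ler_pM2l// /B.
by rewrite lerDl.
Qed.

(** Multiplication is continuous in each variable separately: on the left by a
    fixed operator this uses its adjoint.  Hence an element of A times an element
    of the closure is in the closure, and then so is the product of two elements
    of the closure. *)
Lemma wot_closure_subalgebra (A : set (H -> H)) :
  A `<=` @bounded_operator R I -> subalgebra A -> subalgebra (wot_closure A).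
Proof.
move=> bA [[A0 AD AZ] AM].
have clA := sub_wot_closure bA.
have AclM S T : A S -> wot_closure A T -> wot_closure A (S \o T).
  move=> AS clT; apply/wot_closureP; split.
    by apply: bounded_comp; [exact: bA | exact: wot_closure_bounded clT].
  move=> s e e0.
  have [ys ysE] : exists ys : H -> H, forall x y, inner (S x) y = inner x (ys y).
    have /choice[ys ysE] := fun y => adjoint_exists y (bA _ AS).
    by exists ys => x y; exact: ysE.
  have [T' AT' TT'] := wot_approx [seq (xy.1, ys xy.2) | xy <- s] clT e0.
  exists (S \o T'); first exact: AM.
  move=> [x y] xys.
  change (normc (inner (S (T x)) y - inner (S (T' x)) y) < e).
  rewrite !ysE; apply: TT'.
  by apply/mapP; exists (x, y).
split; first split.
- exact: clA.
- move=> S T clS clT; apply/wot_closureP; split.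
    exact: boundedD (wot_closure_bounded clS) (wot_closure_bounded clT).
  move=> s e e0; have e2 : 0 < e / 2 by rewrite divr_gt0.
  have [S' AS' SS'] := wot_approx s clS e2.
  have [T' AT' TT'] := wot_approx s clT e2.
  exists (S' + T'); first exact: AD.
  move=> [x y] xys.
  change (normc (inner (S x + T x) y - inner (S' x + T' x) y) < e).
  rewrite !innerDl.
  have -> : inner (S x) y + inner (T x) y - (inner (S' x) y + inner (T' x) y) =
    (inner (S x) y - inner (S' x) y) + (inner (T x) y - inner (T' x) y) by ring.
  apply: le_lt_trans (le_normcD _ _) _.
  by have := SS' _ _ xys; have := TT' _ _ xys; lra.
- move=> k T clT; apply/wot_closureP; split.
    by apply: boundedZ; exact: wot_closure_bounded clT.
  move=> s e e0; have k0 : 0 < normc k + 1 by rewrite ltr_wpDl ?normc_ge0.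
  have [T' AT' TT'] := wot_approx s clT (divr_gt0 e0 k0).
  exists (k *: T'); first exact: AZ.
  move=> [x y] xys.
  change (normc (inner (k *: T x) y - inner (k *: T' x) y) < e).
  rewrite !innerZl -mulrBr normcM.
  have := TT' _ _ xys; rewrite ltr_pdivlMr//; apply: le_lt_trans.
  by rewrite mulrC ler_wpM2l ?normc_ge0// lerDl.
move=> S T clS clT; apply/wot_closureP; split.
  exact: bounded_comp (wot_closure_bounded clS) (wot_closure_bounded clT).
move=> s e e0; have e2 : 0 < e / 2 by rewrite divr_gt0.
have [S' AS' SS'] := wot_approx [seq (T xy.1, xy.2) | xy <- s] clS e2.
have [U AU TU] := wot_approx s (AclM _ _ AS' clT) e2.
exists U => // -[x y] xys.
change (normc (inner (S (T x)) y - inner (U x) y) < e).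
have -> : inner (S (T x)) y - inner (U x) y =
  (inner (S (T x)) y - inner (S' (T x)) y) +
  (inner (S' (T x)) y - inner (U x) y) by ring.
apply: le_lt_trans (le_normcD _ _) _.
have := TU _ _ xys; have : normc (inner (S (T x)) y - inner (S' (T x)) y) < e / 2.
  by apply: SS'; apply/mapP; exists (x, y).
move=> /=; lra.
Qed.

End BoundedOperators.

(** * Ideals of an algebra of operators *)

Section OperatorAlgebras.
Variables (K : pzRingType) (H : lmodType K).
Implicit Types (A M N J : set (H -> H)) (a b m j : H -> H).

Lemma linear_subspaceB M a b : linear_subspace M -> M a -> M b -> M (a - b).
Proof.
by move=> [_ MD MZ] Ma Mb; apply: MD => //; rewrite -scaleN1r; exact: MZ.
Qed.

Lemma linear_subspace_sum M (I : Type) (r : seq I) (f : I -> H -> H) :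
  linear_subspace M -> (forall i, M (f i)) -> M (\sum_(i <- r) f i).
Proof.
by move=> [M0 MD MZ] Mf; elim/big_rec: _ => // i a _ Ma; exact: MD.
Qed.

Definition set_add M N : set (H -> H) :=
  [set c | exists m n, [/\ M m, N n & c = m + n]].

Lemma set_add_subspace M N :
  linear_subspace M -> linear_subspace N -> linear_subspace (set_add M N).
Proof.
move=> [M0 MD MZ] [N0 ND NZ]; split.
- by exists 0, 0; rewrite addr0.
- move=> _ _ [m [n [Mm Nn ->]]] [m' [n' [Mm' Nn' ->]]].
  by exists (m + m'), (n + n'); rewrite addrACA; split; [exact: MD|exact: ND|].
- move=> k _ [m [n [Mm Nn ->]]]; exists (k *: m), (k *: n).
  by rewrite scalerDr; split; [exact: MZ|exact: NZ|].
Qed.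

Lemma sub_set_addl M N : linear_subspace N -> M `<=` set_add M N.
Proof. by move=> [N0 _ _] m Mm; exists m, 0; rewrite addr0. Qed.

Lemma sub_set_addr M N : linear_subspace M -> N `<=` set_add M N.
Proof. by move=> [M0 _ _] n Nn; exists 0, n; rewrite add0r. Qed.

Variable A : set (H -> H).
Hypotheses (algA : subalgebra A) (linA : forall a, A a -> linear a).

Lemma left_ideal_add M N :
  left_ideal A M -> left_ideal A N -> left_ideal A (set_add M N).
Proof.
have [[_ AD _] AM] := algA.
move=> [MA lM ideM] [NA lN ideN]; split.
- by move=> _ [m [n [Mm Nn ->]]]; apply: AD; [exact: MA|exact: NA].
- exact: set_add_subspace.
- move=> a _ Aa [m [n [Mm Nn ->]]]; exists (a \o m), (a \o n).
  split; [exact: ideM|exact: ideN|].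
  by apply/funext => x; exact: (linear_mapD (linA Aa)).
Qed.

Lemma ideal_add M N : ideal A M -> ideal A N -> ideal A (set_add M N).
Proof.
move=> [lM rM] [lN rN]; split; first exact: left_ideal_add.
move=> a _ Aa [m [n [Mm Nn ->]]]; exists (m \o a), (n \o a).
by split; [exact: rM|exact: rN|].
Qed.

Hypothesis A1 : A id.

(** If 1 = m + j with j nilpotent then 1 - j^n, the sum of the j^i m for
    i < n, is in M for all n, and it is 1 for large n. *)
Lemma left_ideal_coprime_nilpotent M m j d : left_ideal A M -> A j -> M m ->
  (forall x, x = m x + j x) -> (forall x, iter d j x = 0) -> M = A.
Proof.
move=> [MA [M0 MD _] idM] Aj Mm mj jd.
have key n : M (fun x => x - iter n j x).
  elim: n => [|n IHn].
    have -> : (fun x : H => x - iter 0 j x) = 0 by apply/funext => x; exact: subrr.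
    exact: M0.
  have -> : (fun x => x - iter n.+1 j x) = (fun x => x - iter n j x) + (iter n j \o m).
    apply/funext => x; change (x - iter n.+1 j x = x - iter n j x + iter n j (m x)).
    have linj : linear (iter n j).
      by elim: n {IHn} => [//|n IHn] k y z /=; rewrite IHn (linA Aj).
    have := linear_mapD linj (m x) (j x); rewrite -mj -iterSr => ->.
    by rewrite opprD addrA addrAC subrK.
  apply: MD => //.
  elim: n {IHn} => [|n IHn]; first exact: Mm.
  exact: (idM j _ Aj IHn).
have M1 : M id.
  have -> : id = (fun x : H => x - iter d j x) by apply/funext => x; rewrite jd subr0.
  exact: key.
by apply/seteqP; split => // a Aa; exact: (idM a id Aa M1).
Qed.

Lemma nil_ideal_jacobson J d : ideal A J ->
  (forall j, J j -> forall x, iter d j x = 0) -> J `<=` jacobson_radical A.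
Proof.
move=> [iJ _] nJ; have [JA lJ _] := iJ => a Ja; split; first exact: JA.
move=> M [iM MA maxM] _; have [_ lM _] := iM.
have [E|E] := maxM _ (left_ideal_add iM iJ) (sub_set_addl lJ).
  by rewrite -E; exact: sub_set_addr.
have : set_add M J id by rewrite E.
move=> [m [j [Mm Jj mj]]]; exfalso; apply: MA.
apply: (left_ideal_coprime_nilpotent iM (JA _ Jj) Mm _ (nJ _ Jj)) => x.
exact: (congr1 (@^~ x) mj).
Qed.

Lemma nil_ideal_strong_radical J d : ideal A J ->
  (forall j, J j -> forall x, iter d j x = 0) -> J `<=` strong_radical A.
Proof.
move=> iJ nJ; have [[JA lJ _] _] := iJ => a Ja; split; first exact: JA.
move=> M [iM MA maxM]; have [lidM _] := iM; have [_ lM _] := lidM.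
have [E|E] := maxM _ (ideal_add iM iJ) (sub_set_addl lJ).
  by rewrite -E; exact: sub_set_addr.
have : set_add M J id by rewrite E.
move=> [m [j [Mm Jj mj]]]; exfalso; apply: MA.
apply: (left_ideal_coprime_nilpotent lidM (JA _ Jj) Mm _ (nJ _ Jj)) => x.
exact: (congr1 (@^~ x) mj).
Qed.

End OperatorAlgebras.

(** * Actions by full matrix rings *)

Section MatrixUnits.
Variables (K : fieldType) (H : lmodType K) (A : set (H -> H)).
Hypotheses (algA : subalgebra A) (linA : forall a, A a -> linear a).
Variables (n : nat) (phi : 'I_n -> H -> K) (x : 'I_n -> H).
Variable e : 'I_n -> 'I_n -> H -> H.
Hypothesis phi_linear : forall i k y z, phi i (k *: y + z) = k * phi i y + phi i z.
Hypothesis phi_dual : forall i j, phi i (x j) = (i == j)%:R.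
Hypothesis ker_stable : forall a, A a ->
  forall y, (forall i, phi i y = 0) -> forall i, phi i (a y) = 0.
Hypothesis Ae : forall i j, A (e i j).
Hypothesis eE : forall m i j y, phi m (e i j y) = (m == i)%:R * phi j y.

Let phiD i y z : phi i (y + z) = phi i y + phi i z.
Proof. by have := phi_linear i 1 y z; rewrite scale1r mul1r. Qed.

Let phi0 i : phi i 0 = 0.
Proof. by apply: (addrI (phi i 0)); rewrite -phiD !addr0. Qed.

Let phiZ i k y : phi i (k *: y) = k * phi i y.
Proof. by have := phi_linear i k y 0; rewrite phi0 !addr0. Qed.

Let phiB i y z : phi i (y - z) = phi i y - phi i z.
Proof. by rewrite phiD -scaleN1r phiZ mulN1r. Qed.

Let phi_sum i (J : Type) (r : seq J) (f : J -> H) :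
  phi i (\sum_(j <- r) f j) = \sum_(j <- r) phi i (f j).
Proof.
elim: r => [|j r IHr]; first by rewrite !big_nil phi0.
by rewrite !big_cons phiD IHr.
Qed.

Let phi_ext a y z i : A a -> (forall j, phi j y = phi j z) -> phi i (a y) = phi i (a z).
Proof.
move=> Aa yz; apply/eqP; rewrite -subr_eq0 -phiB -(linear_mapB (linA Aa)).
by apply/eqP/ker_stable => // j; rewrite phiB yz subrr.
Qed.

Let sumK (f : 'I_n -> K) i : \sum_j (i == j)%:R * f j = f i.
Proof.
rewrite (bigD1 i)//= eqxx mul1r big1 ?addr0// => j.
by rewrite eq_sym => /negPf ->; rewrite mul0r.
Qed.

(** The common kernel of the functionals [phi i] is stable under A, so A acts on
    the quotient, of which the classes of the vectors [x i] are a basis and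
    [phi i] the coordinates. *)
Lemma nonzero_on_dual_basis a i y : A a -> phi i (a y) != 0 ->
  exists l, phi i (a (x l)) != 0.
Proof.
move=> Aa ay; apply: contrapT => H0; move: ay.
rewrite (@phi_ext _ _ (\sum_l phi l y *: x l))//; last first.
  move=> j; rewrite phi_sum -[LHS](sumK (fun l => phi l y)).
  by apply: eq_bigr => l _; rewrite phiZ phi_dual mulrC.
rewrite (linear_map_sum (linA Aa)) phi_sum big1 ?eqxx// => l _.
rewrite (linear_mapZ (linA Aa)) phiZ.
have [->|al] := eqVneq (phi i (a (x l))) 0; first by rewrite mulr0.
by case: H0; exists l.
Qed.

(** The kernel of the action is a maximal ideal because matrices form a simple
    ring: the matrix units carry a nonzero entry of b to every place of the
    diagonal, and the sum of the results is a nonzero scalar. *)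
Lemma strong_radical_matrix_units a : strong_radical A a ->
  forall i y, phi i (a y) = 0.
Proof.
move=> [Aa strA] i0 y0; have [[A0 AD AZ] AM] := algA.
pose M := [set b | A b /\ forall i y, phi i (b y) = 0].
suff maxM : maximal_in (ideal A) A M by have [_] := strA _ maxM.
have sM : linear_subspace M.
  split; first by split => // i y; exact: phi0.
    move=> b c [Ab b0] [Ac c0]; split; first exact: AD.
    by move=> i y; rewrite phiD b0 c0 addr0.
  move=> k b [Ab b0]; split; first exact: AZ.
  by move=> i y; rewrite phiZ b0 mulr0.
split.
- split; first split => //.
  + by move=> b [].
  + move=> b m Ab [Am m0]; split; first exact: AM.
    by move=> i y; exact: (ker_stable Ab (fun k => m0 k y)).
  + move=> b m Ab [Am m0]; split; first exact: AM.
    by move=> i y; exact: m0.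
- move=> MA; have : M (e i0 i0) by rewrite MA.
  move=> [_ /(_ i0 (x i0))]; rewrite eE phi_dual eqxx mul1r => /eqP.
  by rewrite oner_eq0.
move=> N [[NA lN lidN] ridN] MN.
have [NM|] := pselect (N `<=` M); first by left; apply/seteqP.
move=> /existsNP[b /not_implyP[Nb /not_andP[|]]]; first by case; exact: NA.
have Ab := NA _ Nb.
move=> /existsNP[j /existsNP[y /eqP /(nonzero_on_dual_basis Ab)[l bl]]].
right; apply/seteqP; split => // c Ac.
set be := phi j (b (x l)) in bl.
pose u := \sum_m (e m j \o b \o e l m).
have Nu : N u.
  by apply: linear_subspace_sum => // m; apply: ridN => //; apply: lidN.
have uE i z : phi i (u z) = be * phi i z.
  rewrite /u fct_sumE phi_sum -(sumK (fun m => be * phi m z)).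
  apply: eq_bigr => m _; rewrite eE; congr (_ * _).
  rewrite /be mulrC -phiZ -(linear_mapZ (linA Ab)).
  by apply: phi_ext => // q; rewrite eE phiZ phi_dual mulrC.
have cN : N (be^-1 *: (c \o u)).
  by have [_ _ NZ] := lN; apply: NZ; exact: lidN.
rewrite -[c](subrK (be^-1 *: (c \o u))); have [_ ND _] := lN.
apply: (ND _ _ _ cN); apply: MN; split.
  exact: (linear_subspaceB algA.1 Ac (NA _ cN)).
move=> i z; change (phi i (c z - be^-1 *: c (u z)) = 0).
rewrite -(linear_mapZ (linA Ac)) phiB; apply/eqP; rewrite subr_eq0; apply/eqP.
by apply: phi_ext => // q; rewrite phiZ uE mulKf.
Qed.

(** The elements that annihilate the class of one basis vector form a maximal
    left ideal because the module of column vectors is simple. *)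
Lemma jacobson_radical_matrix_units a : jacobson_radical A a ->
  forall i y, phi i (a y) = 0.
Proof.
move=> [Aa jacA] i0 y0; have [[A0 AD AZ] AM] := algA.
apply/eqP; apply/negPn/negP => /(nonzero_on_dual_basis Aa)[l].
pose M := [set b | A b /\ forall i, phi i (b (x l)) = 0].
suff maxM : maximal_in (left_ideal A) A M /\ modular_left A M.
  by case: maxM => maxM modM; have [_ ->] := jacA _ maxM modM; rewrite eqxx.
have sM : linear_subspace M.
  split; first by split => // i; exact: phi0.
    move=> b c [Ab b0] [Ac c0]; split; first exact: AD.
    by move=> i; rewrite phiD b0 c0 addr0.
  move=> k b [Ab b0]; split; first exact: AZ.
  by move=> i; rewrite phiZ b0 mulr0.
(* elements fixing the class of x l are right units modulo M *)
have unitM c v : A c -> A v -> (forall q, phi q (v (x l)) = phi q (x l)) ->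
    M (c - (c \o v)).
  move=> Ac Av vl; split; first exact: (linear_subspaceB algA.1 Ac (AM _ _ Ac Av)).
  move=> i; change (phi i (c (x l) - c (v (x l))) = 0); rewrite phiB.
  by apply/eqP; rewrite subr_eq0; apply/eqP/phi_ext.
split; last first.
  by exists (e l l) => // c Ac; rewrite subrr; case: sM.
split.
- split => //; first by move=> b [].
  move=> b m Ab [Am m0]; split; first exact: AM.
  by move=> i; exact: (ker_stable Ab m0).
- move=> MA; have : M (e l l) by rewrite MA.
  move=> [_ /(_ l)]; rewrite eE phi_dual eqxx mul1r => /eqP.
  by rewrite oner_eq0.
move=> N [NA lN lidN] MN.
have [NM|] := pselect (N `<=` M); first by left; apply/seteqP.
move=> /existsNP[b /not_implyP[Nb /not_andP[|]]]; first by case; exact: NA.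
have Ab := NA _ Nb.
move=> /existsNP[j /eqP bl].
right; apply/seteqP; split => // c Ac.
set be := phi j (b (x l)) in bl.
pose v := be^-1 *: (e l j \o b).
have [_ ND NZ] := lN.
have Nv : N v by apply: NZ; exact: lidN.
rewrite -[c](subrK (c \o v)).
apply: (ND); last exact: lidN.
apply: MN; apply: unitM => //; first exact: NA.
move=> q; change (phi q (be^-1 *: e l j (b (x l))) = phi q (x l)).
by rewrite phiZ eE phi_dual mulrCA mulVf// mulr1.
Qed.

End MatrixUnits.

(** * Paths, initial segments and reachability *)

Section PathTheory.
Variable G : digraph.
Implicit Types (p q u v w : dipath G) (x y z : vertex G).

Lemma dipath_ext v w : path_source v = path_source w ->
  path_edges v = path_edges w -> v = w.
Proof.
rewrite /path_source /path_edges => sE eE; apply: val_inj => /=.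
by case: (path_data v) (path_data w) sE eE => [? ?] [? ?] /= -> ->.
Qed.

Lemma path_mulP p q v : path_mul p q = Some v <->
  [/\ path_range q = path_source p, path_source v = path_source q &
      path_edges v = path_edges q ++ path_edges p].
Proof.
split=> [E|[qp sE eE]].
  have qp : path_range q = path_source p by move: E; rewrite /path_mul; case: eqP.
  have := path_mulE qp; rewrite E => -[dv].
  by rewrite /path_source /path_edges dv.
have := path_mulE qp; case: path_mul => //= w [dw]; congr Some.
by apply: dipath_ext; rewrite ?sE ?eE /path_source /path_edges dw.
Qed.

Definition vertex_path x : dipath G := @Dipath G (x, [::]) isT.

Lemma path_mul_vertex u : path_mul u (vertex_path (path_source u)) = Some u.
Proof. exact/path_mulP. Qed.

Lemma path_range_mul p q v : path_mul p q = Some v -> path_range v = path_range p.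
Proof.
move=> /path_mulP[qp sE eE]; rewrite /path_range sE eE map_cat last_cat.
by rewrite -/(path_range q) qp.
Qed.

Definition reach x y : Prop :=
  exists p, path_source p = x /\ path_range p = y.

Lemma reach_refl x : reach x x.
Proof. by exists (vertex_path x). Qed.

Lemma path_mul_def p q : path_range q = path_source p ->
  exists v, path_mul p q = Some v.
Proof. by move=> /path_mulE; case: path_mul => // v _; exists v. Qed.

Lemma reach_trans x y z : reach x y -> reach y z -> reach x z.
Proof.
move=> [q [<- <-]] [p [ps <-]]; have [v vE] := path_mul_def (esym ps).
exists v; rewrite (path_range_mul vE); split => //.
by have /path_mulP[] := vE.
Qed.

Definition initial_segment w v : Prop := exists u, path_mul u w = Some v.

Lemma initial_segment_refl v : initial_segment v v.
Proof. by exists (vertex_path (path_range v)); apply/path_mulP; rewrite cats0. Qed.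

Lemma initial_segment_reach w v :
  initial_segment w v -> reach (path_range w) (path_range v).
Proof.
move=> [u E]; exists u; rewrite (path_range_mul E); split => //.
by have /path_mulP[] := E.
Qed.

Lemma take_walkP v n : is_walk (path_source v) (take n (path_edges v)).
Proof.
have := path_dataP v; rewrite -/(path_source v) -/(path_edges v).
by rewrite -{1}[path_edges v](cat_take_drop n) is_walk_cat => /andP[].
Qed.

Definition take_path v n : dipath G :=
  @Dipath G (path_source v, take n (path_edges v)) (take_walkP v n).

Lemma take_path_initial v n : initial_segment (take_path v n) v.
Proof.
have := path_dataP v; rewrite -/(path_source v) -/(path_edges v).
rewrite -{1}[path_edges v](cat_take_drop n) is_walk_cat => /andP[_ dW].
exists (@Dipath G (_, drop n (path_edges v)) dW); apply/path_mulP; split => //.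
by symmetry; exact: cat_take_drop.
Qed.

Lemma initial_segmentP w v :
  initial_segment w v <-> w = take_path v (size (path_edges w)) /\
    (size (path_edges w) <= size (path_edges v))%N.
Proof.
split=> [[u /path_mulP[_ sE eE]]|[-> ]].
  split; last by rewrite eE size_cat leq_addr.
  by apply: dipath_ext => //=; rewrite /path_edges /= -/(path_edges _) eE take_size_cat.
by move=> _; exact: take_path_initial.
Qed.

Lemma initial_segment_trans u v w :
  initial_segment u v -> initial_segment v w -> initial_segment u w.
Proof.
move=> [p pE] [q /path_mulP[vq sq eq]]; have /path_mulP[up sp ep] := pE.
have pq : path_range p = path_source q by rewrite -vq (path_range_mul pE).
have [r rE] := path_mul_def pq.
have /path_mulP[_ sr er] := rE; exists r; apply/path_mulP.
by rewrite sr sq eq ep er catA.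
Qed.

Lemma path_mulA_right p q u w v : path_mul p q = Some u -> path_mul u w = Some v ->
  exists t, path_mul q w = Some t /\ path_mul p t = Some v.
Proof.
move=> /path_mulP[qp su eu] /path_mulP[wu sv ev].
have wq : path_range w = path_source q by rewrite wu.
have [t tE] := path_mul_def wq; exists t; split => //.
have /path_mulP[_ st et] := tE; apply/path_mulP.
by rewrite (path_range_mul tE) sv st ev eu et catA.
Qed.

Lemma path_mulA_left p q u w v t : path_mul q w = Some t ->
  path_mul p t = Some v -> path_mul u w = Some v -> path_mul p q = Some u.
Proof.
move=> qw /path_mulP[tp sv ev] /path_mulP[wu _ ev'].
have /path_mulP[wq st et] := qw; rewrite (path_range_mul qw) in tp.
apply/path_mulP; split => //; first by rewrite -wu wq.
by move: ev'; rewrite ev et -catA => /eqP; rewrite eqseq_cat// eqxx => /eqP.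
Qed.

End PathTheory.

(** * Invariance properties of the free semigroupoid algebra *)

Section Algebra.
Variables (R : realType) (G : digraph).
Local Notation C := R[i].
Local Notation H := (fock_space R G).
Local Notation A := (free_semigroupoid_algebra R G).
Local Notation xi := (basis R).
Implicit Types (S T : H -> H) (x y : H) (p q u v w : dipath G).

Definition path_algebra : set (H -> H) :=
  smallest (@subalgebra _ H) [set left_mul p | p in [set: dipath G]].

Lemma path_algebra_subalgebra : subalgebra path_algebra.
Proof.
split; first split.
- by move=> B [[[B0 _ _] _] _].
- move=> S T AS AT B HB; have [[[_ BD _] _] _] := HB.
  by apply: BD; [exact: AS|exact: AT].
- move=> k S AS B HB; have [[[_ _ BZ] _] _] := HB.
  by apply: BZ; exact: AS.
- move=> S T AS AT B HB; have [[_ BM] _] := HB.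
  by apply: BM; [exact: AS|exact: AT].
Qed.

Lemma path_algebra_left_mul p : path_algebra (left_mul p).
Proof. by move=> B [_]; apply; exists p. Qed.

Lemma path_algebra_ind (B : set (H -> H)) :
  subalgebra B -> (forall p, B (left_mul p)) -> path_algebra `<=` B.
Proof. by move=> algB BL; apply: smallest_sub => // _ [p _ <-]. Qed.

Lemma bounded_subalgebra : subalgebra (@bounded_operator R (dipath G)).
Proof.
split; first split.
- exact: bounded0.
- exact: boundedD.
- exact: boundedZ.
- exact: bounded_comp.
Qed.

Lemma path_algebra_bounded : path_algebra `<=` @bounded_operator R (dipath G).
Proof.
by apply: path_algebra_ind; [exact: bounded_subalgebra|exact: left_mul_bounded].
Qed.

Lemma fsa_subalgebra : subalgebra A.
Proof.
apply: wot_closure_subalgebra; first exact: path_algebra_bounded.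
exact: path_algebra_subalgebra.
Qed.

Lemma fsa_linear T : A T -> linear T.
Proof. by case=> -[]. Qed.

Lemma fsa_left_mul p : A (left_mul p).
Proof. by apply: sub_wot_closure; [exact: path_algebra_bounded|exact: path_algebra_left_mul]. Qed.

(** The vectors (x, x') of the sum of two copies of H that are orthogonal to the
    vectors (y, -y').  Invariance of such a subspace under the diagonal action of
    T expresses both invariance of a subspace of H (take x' = 0) and commutation
    with an operator on H (take for x' the image of x). *)
Definition agree_on (Y : set (H * H)) x x' : Prop :=
  forall y y', Y (y, y') -> inner x y = inner x' y'.

Lemma fsa_agree_on (Y : set (H * H)) :
  (forall p x x', agree_on Y x x' -> agree_on Y (left_mul p x) (left_mul p x')) ->
  forall T, A T -> forall x x', agree_on Y x x' -> agree_on Y (T x) (T x').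
Proof.
move=> YL.
have Y0 S : path_algebra S ->
    forall x x', agree_on Y x x' -> agree_on Y (S x) (S x').
  apply: (@path_algebra_ind
    [set S | forall x x', agree_on Y x x' -> agree_on Y (S x) (S x')]) => //.
  split; first split.
  - by move=> x x' _ y y' _; rewrite !inner0l.
  - move=> S1 S2 H1 H2 x x' xx' y y' yy'.
    by rewrite !operatorD !innerDl (H1 _ _ xx' _ _ yy') (H2 _ _ xx' _ _ yy').
  - move=> k S1 H1 x x' xx' y y' yy'.
    by rewrite !operatorZ !innerZl (H1 _ _ xx' _ _ yy').
  - by move=> S1 S2 H1 H2 x x' xx'; apply: H1; exact: H2.
move=> T AT x x' xx' y y' yy'.
have := @wot_closure_sum_eq0 R _ path_algebra T
  [:: (1, x, y); (-1, x', y')] AT _.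
rewrite !big_cons big_nil /= addr0 mul1r mulN1r => E.
apply/eqP; rewrite -subr_eq0; apply/eqP; apply: E => S AS.
rewrite !big_cons big_nil /= addr0 mul1r mulN1r.
by rewrite (Y0 S AS _ _ xx' _ _ yy') subrr.
Qed.

Lemma left_mulE p w v x : path_mul p w = Some v -> left_mul p x v = x w.
Proof. exact: left_mul_funE. Qed.

Lemma left_mul0E p v x : (forall w, path_mul p w <> Some v) -> left_mul p x v = 0.
Proof. exact: left_mul_fun0. Qed.

(** In the basis of paths T is triangular.  This holds for L_p, as (L_p x)(v) is
    0 or the value of x at an initial segment of v, and it is inherited because
    initial segments of initial segments of v are initial segments of v. *)
Lemma fsa_local T v x : A T ->
  (forall w, initial_segment w v -> x w = 0) -> T x v = 0.
Proof.
move=> AT x0.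
pose Y := [set yy : H * H | exists2 w, initial_segment w v & yy = (xi w, xi w)].
have YE z : agree_on Y z 0 <-> forall w, initial_segment w v -> z w = 0.
  split=> [zY w wv|z0 y y' [w wv [-> ->]]].
    rewrite -[LHS]inner_basisr (zY _ (xi w)); first by rewrite inner0l.
    by exists w.
  by rewrite !inner_basisr z0.
have Y0 p z z' : agree_on Y z z' -> agree_on Y (left_mul p z) (left_mul p z').
  move=> zz' y y' [w wv [-> ->]]; rewrite !inner_basisr.
  have [[w' w'w]|nw] := pselect (exists w', path_mul p w' = Some w).
    rewrite !(left_mulE _ w'w) -!inner_basisr; apply: zz'; exists w' => //.
    by apply: initial_segment_trans wv; exists p.
  by rewrite !left_mul0E// => w' w'w; apply: nw; exists w'.
have := fsa_agree_on Y0 AT ((YE x).2 x0).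
rewrite (linear_map0 (fsa_linear AT)) => /YE; apply; exact: initial_segment_refl.
Qed.

(** Replaces the expansion of (T x)(v) as the finite sum of the
    x(w) (T xi_w)(v) over the initial segments w of v. *)
Lemma fsa_coord_eq0 T v x : A T ->
  (forall w, initial_segment w v -> x w = 0 \/ T (xi w) v = 0) -> T x v = 0.
Proof.
move=> AT Tx.
pose F := undup [seq take_path v n | n <- iota 0 (size (path_edges v)).+1].
have U : uniq F := undup_uniq _.
have FP w : w \in F <-> initial_segment w v.
  rewrite mem_undup; split.
    by move=> /mapP[n _ ->]; exact: take_path_initial.
  move=> /initial_segmentP[wE wv]; rewrite {1}wE; apply: map_f.
  by rewrite mem_iota /= add0n ltnS.
rewrite -[x](subrK (finite_comb F x)).
rewrite (linear_mapD (fsa_linear AT)) ell2D (_ : T (x - _) v = 0) ?add0r; last first.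
  apply: fsa_local => // w /FP wF.
  by rewrite ell2D ell2N finite_combE// wF subrr.
rewrite /finite_comb (linear_map_sum (fsa_linear AT)) ell2_sum big_seq big1//.
move=> w /FP /Tx H0; rewrite (linear_mapZ (fsa_linear AT)) ell2Z.
by case: H0 => ->; rewrite ?mul0r ?mulr0.
Qed.

(** T commutes with the multiplication by w on the right, which maps the basis
    vector of the vertex r(w) to xi_w; the relation on Y says that x' is the image
    of x under this multiplication. *)
Lemma fsa_right_mul T u w v : A T -> path_mul u w = Some v ->
  T (xi w) v = T (xi (vertex_path (path_range w))) u.
Proof.
move=> AT.
pose Y := [set yy : H * H |
  (exists u v, path_mul u w = Some v /\ yy = (xi u, xi v)) \/
  (exists2 v, ~ initial_segment w v & yy = (0, xi v))].
have YE z z' : agree_on Y z z' <->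
    (forall u v, path_mul u w = Some v -> z u = z' v) /\
    (forall v, ~ initial_segment w v -> z' v = 0).
  split=> [zz'|[H1 H2] y y' [[u' [v' [uv [-> ->]]]]|[v' wv [-> ->]]]].
  - split=> [u' v' uv|v' wv].
      rewrite -[LHS]inner_basisr -[RHS]inner_basisr; apply: zz'.
      by left; exists u', v'.
    rewrite -[LHS]inner_basisr -(zz' 0); first exact: inner0r.
    by right; exists v'.
  - by rewrite !inner_basisr; exact: H1.
  - by rewrite inner0r inner_basisr H2.
have YL p z z' : agree_on Y z z' -> agree_on Y (left_mul p z) (left_mul p z').
  move=> /YE[H1 H2]; apply/YE; split=> [u' v' uv|v' wv]; last first.
    have [[q qv]|nq] := pselect (exists q, path_mul p q = Some v').
      rewrite (left_mulE _ qv); apply: H2 => wq; apply: wv.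
      by apply: initial_segment_trans wq _; exists p.
    by rewrite left_mul0E// => q qv; apply: nq; exists q.
  have [[q qu]|nq] := pselect (exists q, path_mul p q = Some u').
    have [t [qt tv]] := path_mulA_right qu uv.
    by rewrite (left_mulE _ qu) (left_mulE _ tv); exact: H1.
  rewrite [LHS]left_mul0E => [|q qu]; last by apply: nq; exists q.
  have [[t tv]|nt] := pselect (exists t, path_mul p t = Some v').
    rewrite (left_mulE _ tv) H2// => -[q qt]; apply: nq; exists q.
    exact: (path_mulA_left qt tv uv).
  by rewrite left_mul0E// => t tv; apply: nt; exists t.
have xiY : agree_on Y (xi (vertex_path (path_range w))) (xi w).
  apply/YE; split=> [u' v' uv|v' wv]; rewrite !basisE.
    congr (_ %:R); congr nat_of_bool; apply/eqP/eqP => [u'E|v'E].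
      by have /path_mulP[_ sE eE] := uv; apply: dipath_ext; rewrite ?sE ?eE ?u'E ?cats0.
    have /path_mulP[wu' sE eE] := uv; apply: dipath_ext => //.
    apply: size0nil; have /(congr1 size) := eE; rewrite v'E size_cat; lia.
  by case: eqP => // v'E; case: wv; rewrite v'E; exact: initial_segment_refl.
by move=> uw; have /YE[H1 _] := fsa_agree_on YL AT xiY; rewrite (H1 _ _ uw).
Qed.

Definition unit_proj (s : seq (vertex G)) : H -> H :=
  \sum_(z <- s) left_mul (vertex_path z).

Lemma unit_projE s x v : uniq s ->
  unit_proj s x v = if path_range v \in s then x v else 0.
Proof.
move=> U; rewrite /unit_proj fct_sumE ell2_sum.
have E z : left_mul (vertex_path z) x v = if path_range v == z then x v else 0.
  case: eqP => [<-|nz].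
    by apply: left_mulE; apply/path_mulP; rewrite cats0.
  apply: left_mul0E => w wv; have /path_mulP[E1 E2 E3] := wv.
  by apply: nz; rewrite (path_range_mul wv).
under eq_bigr do rewrite E.
case: ifPn => vs; last first.
  by rewrite big_seq big1// => z zs; case: eqP => // vz; rewrite vz zs in vs.
rewrite (bigD1_seq _ vs U) /= eqxx big1; first exact: addr0.
by move=> z /negPf; rewrite eq_sym => ->.
Qed.

Lemma unit_proj_path_algebra s : path_algebra (unit_proj s).
Proof.
apply: (@linear_subspace_sum _ _ path_algebra).
  by case: path_algebra_subalgebra.
by move=> z; exact: path_algebra_left_mul.
Qed.

(** A square summable vector is concentrated on finitely many paths, hence on
    the paths that end in a suitable finite set of vertices. *)
Lemma fsa_id : A id.
Proof.
apply/wot_closureP; split.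
  by split=> //; exists 1 => x; rewrite mul1r.
move=> s e e0.
(* a weight that makes the terms in y of Young's inequality at most e / 2 *)
have [d [d0 dP]] : exists d : R, 0 < d /\ forall xy, xy \in s ->
    ell2_sqnorm xy.2 / d < e / 2.
  elim: s => [|xy s [d [d0 IHs]]]; first by exists 1.
  pose d' := 2 * (ell2_sqnorm xy.2 + 1) / e.
  have d'0 : 0 < d' by rewrite divr_gt0// mulr_gt0// ltr_wpDl// ell2_sqnorm_ge0.
  exists (d + d'); split; first exact: addr_gt0.
  move=> xy'; rewrite inE => /orP[/eqP ->|/IHs].
    rewrite ltr_pdivrMr ?addr_gt0// mulrDr.
    have -> : e / 2 * d' = ell2_sqnorm xy.2 + 1 by rewrite /d'; field; rewrite gt_eqF.
    have : 0 < e / 2 * d by rewrite mulr_gt0// divr_gt0.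
    by move: (ell2_sqnorm _) (e / 2 * d) => *; lra.
  apply: le_lt_trans; rewrite ler_wpM2l ?ell2_sqnorm_ge0//.
  by rewrite lef_pV2 ?posrE ?addr_gt0// lerDl ltW.
have h0 : 0 < e / 2 / d by rewrite !divr_gt0.
have [F FP] : exists F : seq (vertex G), forall F', uniq F' -> {subset F <= F'} ->
    forall xy, xy \in s -> ell2_sqnorm (xy.1 - unit_proj F' xy.1) <= e / 2 / d.
  elim: s {dP} => [|xy s [F IHs]]; first by exists [::].
  have [Fx [Ux Fxe]] := finite_comb_approx xy.1 h0.
  exists (F ++ [seq path_range v | v <- Fx]) => F' U' sub xy'.
  rewrite inE => /orP[/eqP ->|xys]; last first.
    by apply: IHs => // z zF; apply: sub; rewrite mem_cat zF.
  apply: le_trans Fxe; apply: ell2_sqnorm_le => E UE.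
  apply: le_trans (ell2_sum_le _ UE); apply: ler_sum => v _.
  rewrite !ell2D !ell2N unit_projE// finite_combE//.
  case: ifPn => vF'; first by rewrite subrr normc0 expr0n sqr_ge0.
  case: ifPn => // vFx; move: vF'; rewrite sub// mem_cat.
  by rewrite map_f ?orbT.
exists (unit_proj (undup F)); first exact: unit_proj_path_algebra.
move=> [x y] xys.
change (normc (inner x y - inner (unit_proj (undup F) x) y) < e).
rewrite -innerBl; apply: le_lt_trans (inner_young _ _ d0) _.
have FF : {subset F <= undup F} by move=> z; rewrite mem_undup.
have /= H1 := dP _ xys; have /= := FP _ (undup_uniq F) FF _ xys.
by rewrite ler_pdivlMr// mulrC => H2; move: (d * _) H2 => a H2; lra.
Qed.

End Algebra.

(** * Ideals defined by the end points of paths *)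

Section VertexIdeals.
Variables (R : realType) (G : digraph).
Local Notation H := (fock_space R G).
Local Notation A := (free_semigroupoid_algebra R G).
Local Notation xi := (basis R).
Implicit Types (S T : H -> H) (x y : H) (p q u v w : dipath G).

Variable P : vertex G -> vertex G -> Prop.
Hypothesis P_reach : forall a a' b b', reach a' a -> P a b -> reach b b' -> P a' b'.

(** The elements whose Fourier coefficients vanish at u unless
    P (s(u)) (r(u)); in terms of vanishing vectors, the product of two elements
    is controlled without expanding it. *)
Definition vertex_ideal : set (H -> H) :=
  [set T | A T /\ forall v x, (forall w, initial_segment w v ->
     P (path_range w) (path_range v) -> x w = 0) -> T x v = 0].

Lemma vertex_ideal_ideal : ideal A vertex_ideal.
Proof.
have [[A0 AD AZ] AM] := fsa_subalgebra R G.
split; first split.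
- by move=> T [].
- split; first by split.
    move=> S T [AS S0] [AT T0]; split; first exact: AD.
    by move=> v x x0; rewrite operatorD ell2D (S0 _ _ x0) (T0 _ _ x0) addr0.
  move=> k S [AS S0]; split; first exact: AZ.
  by move=> v x x0; rewrite operatorZ ell2Z (S0 _ _ x0) mulr0.
- move=> S T AS [AT T0]; split; first exact: AM.
  move=> v x x0; apply: (fsa_local AS) => w wv; apply: T0 => w' w'w Pw'.
  apply: x0; first exact: initial_segment_trans w'w wv.
  exact: P_reach (reach_refl _) Pw' (initial_segment_reach wv).
- move=> S T AS [AT T0]; split; first exact: AM.
  move=> v x x0; apply: T0 => w wv Pw; apply: (fsa_local AS) => w' w'w.
  apply: x0; first exact: initial_segment_trans w'w wv.
  exact: P_reach (initial_segment_reach w'w) Pw (reach_refl _).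
Qed.

(** The value of T x at v depends only on the values of x at initial segments
    of v whose ranges have larger rank than the range of v, and ranks are
    bounded. *)
Lemma vertex_ideal_nilpotent (rank : vertex G -> nat) (d : nat) T :
  (forall a b, P a b -> reach a b -> (rank b < rank a)%N) ->
  (forall a, (rank a < d)%N) -> vertex_ideal T -> forall x, iter d T x = 0.
Proof.
move=> rankP rank_d [_ T0].
have key n : forall v x, (forall w, initial_segment w v ->
    (n <= rank (path_range w))%N -> x w = 0) -> iter n T x v = 0.
  elim: n => [|n IHn] v x x0; first by apply: x0 => //; exact: initial_segment_refl.
  rewrite iterSr; apply: IHn => w wv nw; apply: T0 => w' w'w Pw'.
  apply: x0; first exact: initial_segment_trans w'w wv.
  exact: leq_ltn_trans nw (rankP _ _ Pw' (initial_segment_reach w'w)).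
move=> x; apply: ell2P_ext => v; apply: key => w _.
by rewrite leqNgt rank_d.
Qed.

Lemma vertex_ideal_sub_radicals (rank : vertex G -> nat) (d : nat) :
  (forall a b, P a b -> reach a b -> (rank b < rank a)%N) ->
  (forall a, (rank a < d)%N) ->
  vertex_ideal `<=` jacobson_radical A `&` strong_radical A.
Proof.
move=> rankP rank_d T JT.
have nilJ j : vertex_ideal j -> forall x, iter d j x = 0.
  exact: vertex_ideal_nilpotent rankP rank_d.
have linA := @fsa_linear R G.
split; first exact: (nil_ideal_jacobson (fsa_subalgebra R G) linA (fsa_id R G)
  vertex_ideal_ideal nilJ).
exact: (nil_ideal_strong_radical (fsa_subalgebra R G) linA (fsa_id R G)
  vertex_ideal_ideal nilJ).
Qed.

End VertexIdeals.

(** * Nilpotent ideals of the free semigroupoid algebra *)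

Section Radical.
Variables (R : realType) (G : digraph).
Local Notation H := (fock_space R G).
Local Notation A := (free_semigroupoid_algebra R G).
Local Notation xi := (basis R).

Definition no_return (x y : vertex G) : Prop := ~ reach y x.

Lemma no_return_reach (a a' b b' : vertex G) :
  reach a' a -> no_return a b -> reach b b' -> no_return a' b'.
Proof.
move=> a'a nab bb' b'a'; apply: nab.
exact: reach_trans bb' (reach_trans b'a' a'a).
Qed.

(** Let u be such that v = u w.  Either u returns, and then T xi_w vanishes at
    v, or it does not and x vanishes at w. *)
Lemma no_return_ideal_coeff (T : H -> H) : A T ->
  (forall u, reach (path_range u) (path_source u) ->
     T (xi (vertex_path (path_source u))) u = 0) ->
  @vertex_ideal R G no_return T.
Proof.
move=> AT T0; split => // v x x0; apply: fsa_coord_eq0 => // w wv.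
have [vw|] := pselect (reach (path_range v) (path_range w)); last by left; exact: x0.
right; have [u uE] := wv; rewrite (fsa_right_mul AT uE).
have /path_mulP[wu _ _] := uE; rewrite wu; apply: T0.
by rewrite -(path_range_mul uE) -wu.
Qed.

Lemma no_return_ideal0 : (forall e : edge G, reach (rng e) (src e)) ->
  @vertex_ideal R G no_return `<=` [set 0].
Proof.
move=> ret T [AT T0]; apply/funext => x; apply: ell2P_ext => v.
apply: T0 => w /initial_segment_reach wv; case.
move: wv => [p [<- <-]]; rewrite /path_source /path_range /path_edges /path_source.
case: p => -[z s] /=; elim: s z => [|e s IHs] z /=; first by move=> _; exact: reach_refl.
by move=> /andP[/eqP <- /IHs h]; exact: reach_trans h (ret e).
Qed.

Lemma no_return_ideal_radicals : finite_set [set: vertex G] ->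
  @vertex_ideal R G no_return `<=` jacobson_radical A `&` strong_radical A.
Proof.
move=> finV; pose s := finmap.enum_fset (fset_set [set: vertex G]).
have sT z : z \in s by rewrite in_fset_set// mem_set.
(* what b reaches is reached from a, and misses a itself *)
pose rank (a : vertex G) := count (fun z => `[< reach a z >]) s.
apply: (vertex_ideal_sub_radicals no_return_reach (rank := rank) (d := (size s).+1)).
  move=> a b nab ab; rewrite /rank -!size_filter.
  set Fa := [seq z <- s | `[< reach a z >]].
  apply: (@leq_trans (size (a :: [seq z <- s | `[< reach b z >]]))) => //.
  apply: uniq_leq_size.
    rewrite /= mem_filter filter_uniq ?finmap.fset_uniq// andbT.
    by apply/negP => /andP[/asboolP].
  move=> z; rewrite inE => /orP[/eqP ->|]; rewrite !mem_filter sT andbT.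
    by apply/asboolP; exact: reach_refl.
  by rewrite andbT => /asboolP bz; apply/asboolP; exact: reach_trans ab bz.
by move=> a; rewrite ltnS count_size.
Qed.

Lemma left_mul_neq0 (p : dipath G) : left_mul (R := R) p <> 0.
Proof.
move=> /(congr1 (fun T : H -> H => T (xi (vertex_path (path_source p))) p)).
rewrite (left_mulE _ (path_mul_vertex p)) basisE eqxx => /eqP.
by rewrite oner_eq0.
Qed.

Definition edge_path (e : edge G) : dipath G :=
  @Dipath G (src e, [:: e]) (introT andP (conj (eqxx _) isT)).

(** Since e does not return, no vertex is both after e and before e, so that the
    ideal of the elements supported by paths from a vertex before e to a vertex
    after e has square 0. *)
Lemma acyclic_edge_radicals (e : edge G) : ~ reach (rng e) (src e) ->
  (jacobson_radical A `&` strong_radical A) (left_mul (edge_path e)).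
Proof.
move=> ne; pose P a b := reach a (src e) /\ reach (rng e) b.
have PP a a' b b' : reach a' a -> P a b -> reach b b' -> P a' b'.
  by move=> a'a [ae eb] bb'; split; [exact: reach_trans a'a ae|exact: reach_trans eb bb'].
apply: (vertex_ideal_sub_radicals PP (rank := fun a => nat_of_bool `[< reach a (src e) >])
  (d := 2)).
- move=> a b [ae eb] _; rewrite (asboolT ae) asboolF// => be; apply: ne.
  exact: reach_trans eb be.
- by move=> a; case: `[< _ >].
split; first exact: fsa_left_mul.
move=> v x x0; have [[w wv]|nv] := pselect (exists w, path_mul (edge_path e) w = Some v).
  rewrite (left_mulE _ wv); apply: x0; first by exists (edge_path e).
  have /path_mulP[wE _ _] := wv; rewrite (path_range_mul wv) wE.
  by split; exact: reach_refl.
by rewrite left_mul0E// => w wv; apply: nv; exists w.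
Qed.

End Radical.

(** * Transitivity and return paths of edges *)

Section TransitiveComponents.
Variable G : digraph.
Implicit Types (K H : subgraph G) (a b x y z : vertex G) (e : edge G).

Let adj H a b := exists2 e, sub_edge H e & src e = a /\ rng e = b.

Let linked_mono H K a b : subgraph_le H K ->
  clos_refl_sym_trans _ (adj H) a b -> clos_refl_sym_trans _ (adj K) a b.
Proof.
move=> [_ HK]; elim=> {a b} [a b [e He ab]|a|a b _ ba|a b c _ ab _ bc].
- by apply: rst_step; exists e => //; exact: HK.
- exact: rst_refl.
- exact: rst_sym.
- exact: rst_trans ab bc.
Qed.

(** Otherwise the edge and its range could be added to the component. *)
Lemma component_edge H e : connected_component H -> sub_vertex H (src e) ->
  sub_edge H e.
Proof.
move=> [cH maxH] He.
pose V := [set z | sub_vertex H z \/ z = rng e].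
pose E := [set e' | sub_edge H e' \/ e' = e].
have Esrc e' : E e' -> V (src e').
  by move=> [/(@sub_source _ H)|->]; left.
have Erng e' : E e' -> V (rng e').
  by move=> [/(@sub_range _ H)|->]; [left|right].
pose K := @Subgraph G V E Esrc Erng.
have HK : subgraph_le H K by split=> z Hz; left.
have cK z : V z -> clos_refl_sym_trans _ (adj K) z (src e).
  case=> [Hz|->]; first exact: linked_mono HK (cH _ _ Hz He).
  by apply/rst_sym/rst_step; exists e => //; right.
have [] := maxH K _ HK.
  by move=> x y Vx Vy; exact: rst_trans (cK _ Vx) (rst_sym _ _ _ _ (cK _ Vy)).
by move=> _; apply; right.
Qed.

Let reach_in H a b := exists p, [/\ {in path_edges p, forall e, sub_edge H e},
  path_source p = a & path_range p = b].

Let reach_in_trans H a b c : reach_in H a b -> reach_in H b c -> reach_in H a c.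
Proof.
move=> [p [Hp <- pb]] [q [Hq qb <-]]; have [v vE] := path_mul_def (etrans pb (esym qb)).
exists v; rewrite (path_range_mul vE); have /path_mulP[_ -> eE] := vE; split=> //.
by move=> e; rewrite eE mem_cat => /orP[/Hp|/Hq].
Qed.

(** The undirected component of the source of e contains both ends of e.
    Conversely, return paths allow every edge to be traversed backwards, and they
    stay inside the component. *)
Lemma transitive_in_each_componentP :
  transitive_in_each_component G <-> forall e : edge G, reach (rng e) (src e).
Proof.
split=> [trG e|ret H cH x y Hx Hy].
  pose E a b := exists e', src e' = a /\ rng e' = b :> vertex G.
  pose V := [set z | clos_refl_sym_trans _ E (src e) z].
  pose F := [set e' | V (src e')].
  have Frng e' : F e' -> V (rng e').
    by move=> Fe'; apply: rst_trans Fe' _; apply: rst_step; exists e'.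
  pose H := @Subgraph G V F (fun _ h => h) Frng.
  (* links between vertices of V only use edges of the subgraph on V *)
  have VH a b : clos_refl_sym_trans _ E a b -> V a ->
      clos_refl_sym_trans _ (adj H) a b.
    elim=> {a b} [a b [e' [<- <-]]|a|a b ab IH|a b c ab IHab bc IHbc] Va.
    - by apply: rst_step; exists e'.
    - exact: rst_refl.
    - by apply/rst_sym/IH; apply: rst_trans Va (rst_sym _ _ _ _ ab).
    - by apply: rst_trans (IHab Va) (IHbc _); exact: rst_trans Va ab.
  have cH : connected_component H.
    split=> [a b Va Vb|K cK [HK _]].
      by apply: VH => //; exact: rst_trans (rst_sym _ _ _ _ Va) Vb.
    have KV z : sub_vertex K z -> V z.
      move=> Kz; have Ke : sub_vertex K (src e) by apply: HK; exact: rst_refl.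
      have := cK _ _ Ke Kz; rewrite /V /=; move: (src e) => a.
      elim=> {z Kz} [b c [e' _ bc]|b|b c _ cb|b c d _ bc _ cd].
      - by apply: rst_step; exists e'.
      - exact: rst_refl.
      - exact: rst_sym.
      - exact: rst_trans bc cd.
    split; first exact: KV.
    by move=> e' Ke'; apply: KV; exact: sub_source.
  have Ve : V (src e) by exact: rst_refl.
  have [p [_ ps pr]] := trG H cH (rng e) (src e) (Frng e Ve) Ve.
  by exists p.
(* paths that start in a component stay in it *)
have walkH p : sub_vertex H (path_source p) -> {in path_edges p, forall e, sub_edge H e}.
  rewrite /path_source /path_edges; case: p => -[z s] /=.
  elim: s z => [//|e s IHs] z /= /andP[/eqP <- sW] Hz e'.
  have He := component_edge cH Hz.
  rewrite inE => /orP[/eqP -> //|]; apply: IHs sW _ _; exact: sub_range.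
have [cH' _] := cH.
suff [] : reach_in H x y /\ reach_in H y x by [].
elim: (cH' _ _ Hx Hy) => {x y Hx Hy} [a b [e He [<- <-]]|a|a b _ [] //|a b c _ [ab ba] _ [bc cb]].
- split; first by exists (edge_path e); split => // e'; rewrite inE => /eqP ->.
  have [p [ps pr]] := ret e; exists p; split => //.
  by apply: walkH; rewrite ps; exact: sub_range.
- by split; exists (vertex_path a); split.
- by split; [exact: reach_in_trans ab bc|exact: reach_in_trans cb ba].
Qed.

End TransitiveComponents.

(** * The matrix representation attached to a periodic walk *)

Lemma geometric_half_sum (R : realFieldType) (N : nat) :
  \sum_(n <- iota 0 N) (2^-1 : R) ^+ n <= 2.
Proof.
suff E : \sum_(n <- iota 0 N) (2^-1 : R) ^+ n + 2 * 2^-1 ^+ N = 2.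
  have : 0 <= 2 * (2^-1 : R) ^+ N by rewrite mulr_ge0// exprn_ge0// invr_ge0.
  by move: E; set s := \sum_(_ <- _) _; set t := _ * _; lra.
elim: N => [|N IHN]; first by rewrite big_nil add0r expr0 mulr1.
rewrite -[N.+1]addn1 iotaD big_cat big_seq1 add0n /= -[RHS]IHN -addrA; congr (_ + _).
by rewrite addn1 exprS; field.
Qed.

Section PeriodicWalks.
Variable G : digraph.
Variables (f : nat -> edge G) (k : nat).
Hypothesis k_gt0 : (0 < k)%N.
Hypothesis f_walk : forall n, src (f n.+1) = rng (f n).
Hypothesis f_per : forall n, f (n + k) = f n.
Hypothesis f_min : forall d, (0 < d)%N -> (forall n, f (n + d) = f n) -> (k <= d)%N.
Implicit Types (p w v : dipath G) (m n : nat).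

Lemma walk_perM n a : f (n + a * k) = f n.
Proof. by elim: a => [|a IHa]; rewrite ?addn0// mulSn addnCA addnC f_per. Qed.

Lemma walk_mod n : f (n %% k) = f n.
Proof. by rewrite [in RHS](divn_eq n k) addnC walk_perM. Qed.

Lemma walk_eqmod m n : m = n %[mod k] -> f m = f n.
Proof. by move=> mn; rewrite -walk_mod mn walk_mod. Qed.

Lemma window_walkP m n : is_walk (src (f m)) [seq f i | i <- iota m n].
Proof.
elim: n m => [//|n IHn] m /=; rewrite eqxx /= -f_walk; exact: IHn.
Qed.

Definition window m n : dipath G :=
  @Dipath G (src (f m), [seq f i | i <- iota m n]) (window_walkP m n).

Lemma window_range m n : path_range (window m n) = src (f (m + n)).
Proof.
rewrite /path_range /path_source /path_edges /=.
elim: n m => [|n IHn] m /=; first by rewrite addn0.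
by rewrite -f_walk IHn addSnnS.
Qed.

Lemma size_window m n : size (path_edges (window m n)) = n.
Proof. by rewrite /path_edges /= size_map size_iota. Qed.

Lemma window_mul m n n' :
  path_mul (window (m + n) n') (window m n) = Some (window m (n + n')).
Proof.
apply/path_mulP; rewrite window_range; split => //.
by rewrite /path_edges /= iotaD map_cat.
Qed.

Lemma window_factor p w N : path_mul p w = Some (window 0 N) ->
  [/\ w = window 0 (size (path_edges w)),
      p = window (size (path_edges w)) (size (path_edges p)) &
      N = (size (path_edges w) + size (path_edges p))%N].
Proof.
move=> /path_mulP[wp sE eE].
have NE : N = (size (path_edges w) + size (path_edges p))%N.
  by rewrite -size_cat -eE size_window.
set a := size (path_edges w) in NE *.
have [we pe] : path_edges w = path_edges (window 0 a) /\
    path_edges p = path_edges (window a (size (path_edges p))).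
  move/eqP: eE; rewrite NE {1}/path_edges /= iotaD map_cat.
  rewrite eqseq_cat ?size_map ?size_iota// => /andP[/eqP wE /eqP pE].
  by split; [exact: esym wE|exact: esym pE].
have wE : w = window 0 a by apply: dipath_ext => //; rewrite -sE.
split => //; apply: dipath_ext => //.
by rewrite -wp wE window_range add0n.
Qed.

Lemma window_eqmod m m' n : m = m' %[mod k] -> window m n = window m' n.
Proof.
move=> mm'; apply: dipath_ext; first exact: (congr1 (@src G) (walk_eqmod mm')).
rewrite /path_edges /= -[m]addn0 -[m']addn0 !iotaDl -!map_comp.
by apply: eq_map => i /=; apply: walk_eqmod; rewrite -modnDml mm' modnDml.
Qed.

(** If the windows at m and m' agree over a whole period then the walks from m
    and from m' agree for ever, so m' - m is a period and is divisible by the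
    minimal one. *)
Lemma window_eqmodP m m' n : (k <= n)%N -> window m n = window m' n ->
  m = m' %[mod k].
Proof.
move=> kn /(congr1 (@path_edges G)); rewrite /path_edges /= => E.
have {}E i : f (m + i) = f (m' + i).
  have ik : (i %% k < n)%N := leq_trans (ltn_pmod i k_gt0) kn.
  have fm (a : nat) : f (a + i) = f (a + i %% k).
    by apply: walk_eqmod; rewrite modnDmr.
  have := congr1 (fun s => nth (f 0) s (i %% k)) E.
  by rewrite !(nth_map 0%N) ?size_iota// !nth_iota// !fm.
wlog mm' : m m' E / (m <= m')%N.
  by move=> H; have [/H|/ltnW /H] := leqP m m'; [exact|move=> /(_ _)/esym; exact].
pose d := (m' - m)%N.
have per n0 : f (n0 + d) = f n0.
  rewrite -(walk_perM n0 m) -(walk_perM (n0 + d) m).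
  have mk : (m <= m * k)%N by rewrite leq_pmulr.
  have := E (n0 + m * k - m)%N.
  have -> : (m + (n0 + m * k - m) = n0 + m * k)%N by lia.
  have -> : (m' + (n0 + m * k - m) = n0 + d + m * k)%N by rewrite /d; lia.
  by [].
have per' n0 : f (n0 + d %% k) = f n0.
  by rewrite -(per n0); apply: walk_eqmod; rewrite modnDmr.
have dk : (d %% k)%N = 0%N.
  have [//|d0] := posnP (d %% k)%N.
  by have := f_min d0 per'; rewrite leqNgt ltn_pmod.
by rewrite -(subnKC mm') -/d -modnDmr dk addn0.
Qed.

Section Representation.
Variable R : realType.
Local Notation C := R[i].
Local Notation H := (fock_space R G).
Local Notation A := (free_semigroupoid_algebra R G).
Local Notation xi := (basis R).
Local Notation len v := (size (path_edges v)).
Implicit Types (T : H -> H) (x y : H) (t : R).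

Definition on_walk v : bool := v == window 0 (len v).

(** The walk has a single initial part of each length, so the sum is dominated
    by a geometric series. *)
Lemma on_walk_summable (g : dipath G -> C) (K : R) :
  (forall v, normc (g v) <= (on_walk v)%:R * (K * 2^-1 ^+ len v)) ->
  forall F, uniq F -> \sum_(v <- F) normc (g v) ^+ 2 <= 2 * K ^+ 2.
Proof.
move=> gK F U.
pose F1 := [seq v <- F | on_walk v].
pose N := \max_(v <- F1) (len v).+1.
apply: (@le_trans _ _ (\sum_(v <- F1) K ^+ 2 * 2^-1 ^+ len v)).
  rewrite big_filter [leRHS]big_mkcond; apply: ler_sum => v _.
  have := gK v; case: ifP => _; rewrite ?mul0r ?mul1r => gv.
    apply: (@le_trans _ _ ((K * 2^-1 ^+ len v) ^+ 2)).
      by rewrite ler_sqr ?nnegrE ?normc_ge0// (le_trans (normc_ge0 _) gv).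
    have h0 : 0 <= (2^-1 : R) ^+ len v by rewrite exprn_ge0// invr_ge0.
    have h1 : (2^-1 : R) ^+ len v <= 1 by rewrite exprn_ile1// ?invr_ge0// invf_le1// ler1n.
    rewrite exprMn ler_wpM2l ?sqr_ge0//; move: h0 h1; set h := _ ^+ len v => h0 h1.
    by rewrite expr2 ler_piMr.
  have -> : normc (g v) = 0 by apply/le_anti; rewrite gv normc_ge0.
  by rewrite expr0n.
rewrite -mulr_sumr mulrC ler_wpM2r ?sqr_ge0//.
apply: le_trans (geometric_half_sum R N).
rewrite -(big_map (fun v => len v) xpredT (fun n => 2^-1 ^+ n)).
apply: sum_subset_le.
- by move=> n; rewrite exprn_ge0// invr_ge0.
- rewrite map_inj_in_uniq ?filter_uniq// => v w.
  rewrite !mem_filter => /andP[/eqP vE _] /andP[/eqP wE _] vw.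
  by rewrite vE vw -wE.
- exact: iota_uniq.
move=> _ /mapP[v vF ->]; rewrite mem_iota add0n /= /N.
by rewrite (bigD1_seq v) //= ?filter_uniq// leq_maxl.
Qed.

Definition walk_sum_fun (c : nat -> R) (v : dipath G) : C :=
  if on_walk v then (c (len v))%:C else 0.

Lemma normc_real (a : R) : normc a%:C = `|a|.
Proof. by rewrite /= expr0n /= addr0 sqrtr_sqr. Qed.

Lemma walk_sum_subproof (c : nat -> R) (K : R) :
  (forall n, `|c n| <= K * 2^-1 ^+ n) ->
  forall v, normc (walk_sum_fun c v) <= (on_walk v)%:R * (K * 2^-1 ^+ len v).
Proof.
move=> cK v; rewrite /walk_sum_fun; case: ifP => _.
  by rewrite normc_real mul1r.
by rewrite normc0 mul0r.
Qed.

Lemma walk_sum_exists (c : nat -> R) (K : R) :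
  (forall n, `|c n| <= K * 2^-1 ^+ n) ->
  exists z : H, (forall v, z v = walk_sum_fun c v) /\ ell2_sqnorm z <= 2 * K ^+ 2.
Proof.
move=> cK; have gK := on_walk_summable (walk_sum_subproof cK).
by exists (Ell2 (square_summable_bound gK)); split => //; exact: ell2_sqnorm_le.
Qed.

Definition geometric_coef t (j n : nat) : R :=
  (n == j %[mod k])%:R * t ^+ n.

Lemma geometric_coef_le t j n : 0 < t -> t <= 2^-1 ->
  `|geometric_coef t j n| <= 1 * 2^-1 ^+ n.
Proof.
move=> t0 t1; rewrite mul1r /geometric_coef; case: eqP => _; last first.
  by rewrite mul0r normr0 exprn_ge0// invr_ge0.
rewrite mul1r ger0_norm ?exprn_ge0 ?(ltW t0)//.
by rewrite lerXn2r// nnegrE ?invr_ge0// ltW.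
Qed.

Section FixedRatio.
Variable t : R.
Hypotheses (t_gt0 : 0 < t) (t_le : t <= 2^-1).

(** The sum of the t^n xi_(window 0 n) over the n congruent to j modulo k. *)
Definition zeta (j : nat) : H :=
  projT1 (cid (walk_sum_exists (fun n => geometric_coef_le j n t_gt0 t_le))).

Lemma zetaE j v : zeta j v = walk_sum_fun (geometric_coef t j) v.
Proof. by rewrite /zeta; case: cid => z [/= ->]. Qed.

Lemma zeta_window j n : zeta j (window 0 n) = (geometric_coef t j n)%:C.
Proof. by rewrite zetaE /walk_sum_fun /on_walk size_window eqxx. Qed.

Lemma zeta_off j v : ~~ on_walk v -> zeta j v = 0.
Proof. by move=> nv; rewrite zetaE /walk_sum_fun (negPf nv). Qed.

Lemma zeta_eqmod j j' : j = j' %[mod k] -> zeta j = zeta j'.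
Proof.
move=> jj'; apply: ell2P_ext => v; rewrite !zetaE /walk_sum_fun /geometric_coef.
by rewrite jj'.
Qed.

(** The adjoint of L_p cuts off the last edges of a path if they form p, and
    kills the other paths.  Applied to zeta_j, whose paths all end at the place j
    of the walk, it gives a multiple of zeta_m, or 0 if p is not the window of the
    walk that ends at j. *)
Lemma inner_left_mul_zeta p j m y : (m + len p = j %[mod k])%N ->
  inner (left_mul p y) (zeta j) =
  ((p == window m (len p))%:R * t ^+ len p)%:C * inner y (zeta m).
Proof.
move=> mj; have [z zE] := adjoint_exists (zeta j) (left_mul_bounded R p).
rewrite zE -inner_real_scaler; apply: eq_innerr => w _.
have := zE (xi w); rewrite inner_basisl left_mul_basis => /(congr1 conjc).
rewrite conjcK => <-; rewrite ell2Z.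
case pw: path_mul => [v|]; last first.
  rewrite inner0l conjc0; case: eqP => [pE|_]; last by rewrite mul0r mul0r.
  have [wE|nw] := boolP (on_walk w); last by rewrite zeta_off// mulr0.
  rewrite (eqP wE) zeta_window /geometric_coef; case: eqP => [wm|_]; last first.
    by rewrite mul0r mulr0.
  have := window_mul 0 (len w) (len p); rewrite -(eqP wE) add0n.
  by rewrite (window_eqmod _ wm) -pE pw.
rewrite inner_basisl conjcK.
have [vE|nv] := boolP (on_walk v).
  have := pw; rewrite (eqP vE) => /window_factor[wE pE lE].
  rewrite [in LHS]zeta_window [in RHS]wE zeta_window /geometric_coef lE.
  have -> : (len w + len p == j %[mod k])%N = (len w == m %[mod k])%N.
    by rewrite -mj eqn_modDr.
  case: eqP => [wm|_]; last by rewrite !mul0r mulr0.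
  have -> : p == window m (len p) by apply/eqP; rewrite {1}pE; exact: window_eqmod.
  by rewrite !mul1r -rmorphM -exprD addnC.
rewrite zeta_off//; case: eqP => [pE|_]; last by rewrite mul0r mul0r.
have [wE|nw] := boolP (on_walk w); last by rewrite zeta_off// mulr0.
rewrite (eqP wE) zeta_window /geometric_coef; case: eqP => [wm|_]; last first.
  by rewrite mul0r mulr0.
have := window_mul 0 (len w) (len p); rewrite -(eqP wE) add0n.
rewrite (window_eqmod _ wm) -pE pw => -[vE]; move: nv.
by rewrite /on_walk vE size_window eqxx.
Qed.

Let prev j n := ((j + (k * n - n)) %% k)%N.

Let prevK j n : (prev j n + n = j %[mod k])%N.
Proof.
rewrite /prev modnDml -addnA subnK ?leq_pmull//.
by rewrite -modnDmr modnMr addn0.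
Qed.

Let prev_lt j n : (prev j n < k)%N. Proof. exact: ltn_pmod. Qed.

Let phi (i : 'I_k) (y : H) : C := inner y (zeta i).

Let dualv (i : 'I_k) : H := (t ^- i)%:C *: xi (window 0 i).

Let dual i j : phi i (dualv j) = (i == j)%:R.
Proof.
rewrite /phi /dualv innerZl inner_basisl zeta_window conjc_real /geometric_coef.
have -> : (j == i %[mod k])%N = (i == j) by rewrite !modn_small// eq_sym.
have [<-|_] := eqVneq i j; last by rewrite mul0r mulr0.
by rewrite mul1r -rmorphM /= mulVf// expf_neq0// gt_eqF.
Qed.

Let stable T : A T -> forall y, (forall i, phi i y = 0) -> forall i, phi i (T y) = 0.
Proof.
move=> AT y y0 i.
pose Y := [set yy : H * H | exists i : 'I_k, yy = (zeta i, zeta i)].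
have YE z : agree_on Y z 0 <-> forall i, phi i z = 0.
  split=> [zY l|z0 _ _ [l [-> ->]]].
    by rewrite /phi (zY _ (zeta l)) ?inner0l//; exists l.
  by rewrite inner0l; exact: z0.
have YL p z z' : agree_on Y z z' -> agree_on Y (left_mul p z) (left_mul p z').
  move=> zz' _ _ [l [-> ->]].
  rewrite !(inner_left_mul_zeta _ (prevK l (len p))); congr (_ * _).
  by apply: zz'; exists (Ordinal (prev_lt l (len p))).
have := fsa_agree_on YL AT ((YE y).2 y0).
by rewrite (linear_map0 (fsa_linear AT)) => /YE.
Qed.

(** A length at least k, for the window from j to determine its place in the
    walk, and congruent to i - j, for this window to end at i. *)
Let unit_len (i j : 'I_k) : nat := (k + k + i - j)%N.
Let munit (i j : 'I_k) : H -> H :=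
  (t ^- unit_len i j)%:C *: left_mul (window j (unit_len i j)).

Let munitE (l i j : 'I_k) y : phi l (munit i j y) = (l == i)%:R * phi j y.
Proof.
set n := unit_len i j.
have kn : (k <= n)%N by rewrite /n /unit_len; have := ltn_ord j; lia.
have jn : (j + n = i %[mod k])%N.
  have -> : (j + n = i + 2 * k)%N by rewrite /n /unit_len; have := ltn_ord j; lia.
  by rewrite -modnDmr modnMl addn0.
rewrite /munit operatorZ /phi innerZl -/n.
rewrite (inner_left_mul_zeta _ (prevK l (len (window j n)))) size_window.
have t0 : t ^+ n != 0 by rewrite expf_neq0// gt_eqF.
have [->|li] := eqVneq l i.
  have ij : prev i n = j %[mod k].
    by apply/eqP; rewrite -(eqn_modDr n) prevK jn.
  rewrite (window_eqmod n ij) (zeta_eqmod ij) eqxx !mul1r mulrA -rmorphM /=.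
  by rewrite mulVf// mul1r.
case: eqP => [/(window_eqmodP kn) jm|_]; last by rewrite !mul0r mulr0.
case/eqP: li; apply: val_inj; rewrite /= -[l : nat](@modn_small _ k)//.
by rewrite -[i : nat](@modn_small _ k)// -jn -(prevK l n) -modnDml -jm modnDml.
Qed.

Lemma radical_inner_zeta T j y :
  jacobson_radical A T \/ strong_radical A T -> inner (T y) (zeta j) = 0.
Proof.
have -> : zeta j = zeta (Ordinal (ltn_pmod j k_gt0)).
  by apply: zeta_eqmod; rewrite modn_mod.
have linA := @fsa_linear R G.
have phi_lin i (c : C) x z : phi i (c *: x + z) = c * phi i x + phi i z.
  exact: inner_linearl.
have Amunit i j' : A (munit i j').
  have [[_ _ AZ] _] := fsa_subalgebra R G.
  by apply: AZ; exact: fsa_left_mul.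
case=> radT.
  exact: (jacobson_radical_matrix_units (fsa_subalgebra R G) linA phi_lin dual stable
    Amunit munitE radT).
exact: (strong_radical_matrix_units (fsa_subalgebra R G) linA phi_lin dual stable
    Amunit munitE radT).
Qed.

End FixedRatio.

(** The lowest nonzero term of a power series dominates: if y vanishes at the
    shorter initial parts of the walk then <y, zeta> = t^n (y_n + t <y, z>) with
    z bounded independently of t. *)
Lemma orthogonal_zeta_coef y :
  (forall t (t0 : 0 < t) (t1 : t <= 2^-1) j, inner y (zeta t0 t1 j) = 0) ->
  forall n, y (window 0 n) = 0.
Proof.
move=> y0 n; elim/ltn_ind: n => n IHn.
pose B := ell2_sqnorm y + 2 * (2 ^+ n.+1) ^+ 2.
have B0 : 0 <= B by rewrite addr_ge0 ?ell2_sqnorm_ge0// mulr_ge0// sqr_ge0.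
have key t : 0 < t -> t <= 2^-1 -> normc (y (window 0 n)) <= t * B.
  move=> t0 t1.
  pose c m := (n < m)%N%:R * ((m == n %[mod k])%:R * t ^+ (m - n.+1)).
  have cK m : `|c m| <= 2 ^+ n.+1 * 2^-1 ^+ m.
    rewrite /c; case: ltnP => nm; last by rewrite mul0r normr0 mulr_ge0// exprn_ge0// invr_ge0.
    rewrite mul1r.
    have -> : 2 ^+ n.+1 * 2^-1 ^+ m = 2^-1 ^+ (m - n.+1) :> R.
      rewrite -{1}(subnKC nm) exprD mulrA -exprMn divff ?expr1n ?mul1r//.
    have E0 : 0 <= t ^+ (m - n.+1) by rewrite exprn_ge0// ltW.
    apply: (@le_trans _ _ (t ^+ (m - n.+1))).
      by case: eqP => _; rewrite ?mul1r ?mul0r ?normr0// ger0_norm.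
    by rewrite lerXn2r// nnegrE ?invr_ge0// ltW.
  have [z [zE zB]] := walk_sum_exists cK.
  have := y0 t t0 t1 n.
  rewrite (@eq_innerr _ _ _ _ ((t ^+ n)%:C *: xi (window 0 n) + (t ^+ n.+1)%:C *: z)).
    rewrite innerDr !inner_real_scaler inner_basisr exprS rmorphM -mulrA mulrCA -mulrDr.
    move=> /eqP; rewrite mulf_eq0 => /orP[|].
      by rewrite fmorph_eq0 expf_eq0 gt_eqF ?andbF.
    rewrite addr_eq0 => /eqP ->; rewrite normcN normcM normc_real ger0_norm ?(ltW t0)//.
    rewrite ler_pM2l//; apply: le_trans (inner_young _ _ ltr01) _.
    by rewrite mul1r divr1 lerD2l.
  move=> v yv; rewrite zetaE ell2D !ell2Z zE basisE /walk_sum_fun.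
  have [vE|nv] := boolP (on_walk v); last first.
    case: eqP => [vE|_]; last by rewrite !mulr0 addr0.
    by move: nv; rewrite /on_walk vE size_window eqxx.
  rewrite (eqP vE) size_window /geometric_coef /c.
  have [mn|mn|mn] := ltngtP (len v) n.
  - by move: yv; rewrite (eqP vE) IHn ?eqxx.
  - have -> : (window 0 (len v) == window 0 n) = false.
      by apply/eqP => /(congr1 (fun v => len v)); rewrite !size_window => E; rewrite E ltnn in mn.
    rewrite mulr0 add0r mul1r -rmorphM mulrCA -exprD.
    by rewrite subnKC.
  - by rewrite mn !eqxx mul0r mulr0 addr0 mul1r mulr1.
apply/eq0_normc/le_anti; rewrite normc_ge0 andbT; apply/ler_addgt0Pr => e e0.
rewrite add0r.
pose t := Num.min (2^-1) (e / (B + 1)).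
have B1 : 0 < B + 1 by rewrite ltr_wpDl.
have t0 : 0 < t by rewrite lt_min invr_gt0 ltr0n divr_gt0.
have t1 : t <= 2^-1 by rewrite ge_min lexx.
apply: le_trans (key t t0 t1) _.
have : t * (B + 1) <= e.
  by rewrite -ler_pdivlMr// ge_min lexx orbT.
by rewrite mulrDr mulr1; move: (t * B) => a; lra.
Qed.

End Representation.
End PeriodicWalks.

(** * Coefficients of elements of the radicals *)

Section RadicalCoefficients.
Variables (R : realType) (G : digraph).
Local Notation H := (fock_space R G).
Local Notation A := (free_semigroupoid_algebra R G).
Local Notation xi := (basis R).
Implicit Types (T : H -> H) (u q : dipath G).

(** The case of the matrices of size 1: the coefficient at a vertex is
    multiplicative. *)
Lemma radical_vertex_coef T u : path_edges u = [::] ->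
  jacobson_radical A T \/ strong_radical A T -> forall y, T y u = 0.
Proof.
move=> u0 radT y.
pose phi (i : 'I_1) (y : H) := y u.
have seg w : initial_segment w u -> w = u.
  move=> /initial_segmentP[wE]; rewrite u0 leqn0 => /eqP w0.
  by apply: dipath_ext; rewrite ?(size0nil w0) ?u0// wE.
have Lu (x : H) : left_mul u x u = x u.
  apply: left_mulE; apply/path_mulP; rewrite u0; split => //.
  by rewrite /path_range u0.
have linA := @fsa_linear R G.
have phi_lin i (c : R[i]) x z : phi i (c *: x + z) = c * phi i x + phi i z by [].
have dual (i j : 'I_1) : phi i (xi u) = (i == j)%:R.
  by rewrite /phi basisE eqxx !ord1.
have stable S : A S -> forall x, (forall i, phi i x = 0) -> forall i, phi i (S x) = 0.
  move=> AS x x0 i; apply: (fsa_local AS) => w /seg ->; exact: (x0 ord0).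
have unitE (m i j : 'I_1) x : phi m (left_mul u x) = (m == i)%:R * phi j x.
  by rewrite /phi Lu !ord1 mul1r.
case: radT => radT.
  exact: (@jacobson_radical_matrix_units _ _ A (fsa_subalgebra R G) linA 1 phi
    (fun _ => xi u) (fun _ _ => left_mul u) phi_lin dual stable
    (fun _ _ => fsa_left_mul R u) unitE T radT ord0 y).
exact: (@strong_radical_matrix_units _ _ A (fsa_subalgebra R G) linA 1 phi
    (fun _ => xi u) (fun _ _ => left_mul u) phi_lin dual stable
    (fun _ _ => fsa_left_mul R u) unitE T radT ord0 y).
Qed.

Lemma nth_walk (x : vertex G) e0 (s : seq (edge G)) i : is_walk x s ->
  (i < size s)%N -> src (nth e0 s i) = last x (map (@rng G) (take i s)).
Proof.
elim: s x i => [//|e s IHs] x [|i] /= /andP[/eqP ex sW] //.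
by rewrite ltnS => /(IHs _ _ sW).
Qed.

(** A closed walk that begins with u is repeated periodically; the period of the
    result may be smaller than the length of that walk, and the minimal one is
    used. *)
Lemma radical_return_coef T u :
  jacobson_radical A T \/ strong_radical A T ->
  reach (path_range u) (path_source u) ->
  T (xi (vertex_path (path_source u))) u = 0.
Proof.
move=> radT [q [qu uq]].
have [c cE] := path_mul_def (esym qu).
have [u0|] := eqVneq (path_edges u) [::]; first exact: radical_vertex_coef.
case uE: (path_edges u) => [//|e0 s0] _.
have /path_mulP[_ sc ec] := cE; have rc := path_range_mul cE.
pose s := path_edges c.
have sW : is_walk (path_source u) s by rewrite -sc; exact: (path_dataP c).
have s_gt0 : (0 < size s)%N by rewrite /s ec uE.
have s_last : last (path_source u) (map (@rng G) s) = path_source u.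
  by rewrite -[RHS]uq -rc -sc.
pose f n := nth e0 s (n %% size s).
have src_f n : src (f n) = last (path_source u) (map (@rng G) (take (n %% size s) s)).
  by apply: nth_walk => //; rewrite ltn_pmod.
have f_walk n : src (f n.+1) = rng (f n).
  rewrite src_f /f; have ns := ltn_pmod n s_gt0.
  have E : last (path_source u) (map (@rng G) (take (n %% size s).+1 s)) =
      rng (nth e0 s (n %% size s)).
    by rewrite (take_nth e0)// map_rcons last_rcons.
  rewrite -E -addn1 -modnDml addn1.
  have [lt|ge] := ltnP (n %% size s).+1 (size s); first by rewrite modn_small.
  have -> : (n %% size s).+1 = size s by apply/eqP; rewrite eqn_leq ns ge.
  by rewrite modnn take0 take_size s_last.
pose period d := `[< (0 < d)%N /\ forall n, f (n + d) = f n >].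
have ex_period : exists d, period d.
  by exists (size s); apply/asboolP; split => // n; rewrite /f modnDr.
have [k /asboolP[k0 f_per] k_min] := ex_minnP ex_period.
have f_min d : (0 < d)%N -> (forall n, f (n + d) = f n) -> (k <= d)%N.
  by move=> d0 fd; apply: k_min; apply/asboolP.
have f0 : src (f 0) = path_source u by rewrite src_f mod0n take0.
have uW : u = window f_walk 0 (size (path_edges u)).
  apply: dipath_ext; first by rewrite /path_source /= f0.
  rewrite [RHS]/path_edges /=; apply: (@eq_from_nth _ e0).
    by rewrite size_map size_iota.
  move=> i iu; rewrite (nth_map 0%N) ?size_iota// nth_iota// add0n /f.
  rewrite modn_small /s ec ?size_cat ?(leq_trans iu) ?leq_addr//.
  by rewrite nth_cat iu.
rewrite [in LHS]uW; apply: (@orthogonal_zeta_coef _ f k) => t t0 t1 j.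
exact: (radical_inner_zeta k0).
Qed.

Lemma radicals_sub_no_return_ideal :
  jacobson_radical A `|` strong_radical A `<=` @vertex_ideal R G (@no_return G).
Proof.
move=> T radT; apply: no_return_ideal_coeff; first by case: radT => -[].
by move=> u; exact: radical_return_coef.
Qed.

End RadicalCoefficients.

Theorem corollary4p5 (R : realType) (G : digraph) :
  [/\ semisimple (free_semigroupoid_algebra R G) <->
        strongly_semisimple (free_semigroupoid_algebra R G),
      strongly_semisimple (free_semigroupoid_algebra R G) <->
        transitive_in_each_component G
    & finite_set [set: vertex G] ->
        jacobson_radical (free_semigroupoid_algebra R G) =
        strong_radical (free_semigroupoid_algebra R G)].
Proof.
set A := free_semigroupoid_algebra R G.
have A0 : A 0 by case: (fsa_subalgebra R G) => -[].
have jac0 : jacobson_radical A 0 by split=> // M [[_ [M0 _ _] _] _ _] _.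
have strong0 : strong_radical A 0 by split=> // M [[[_ [M0 _ _] _] _] _ _].
have rad_sub := @radicals_sub_no_return_ideal R G.
have transE := transitive_in_each_componentP G.
have trans_ss : transitive_in_each_component G ->
    semisimple A /\ strongly_semisimple A.
  move=> /transE ret; split; apply/seteqP; split=> T //=; try by move=> ->.
    by move=> radT; apply: (no_return_ideal0 ret); apply: rad_sub; left.
  by move=> radT; apply: (no_return_ideal0 ret); apply: rad_sub; right.
have ss_trans : semisimple A \/ strongly_semisimple A ->
    transitive_in_each_component G.
  move=> ssA; apply/transE => e; apply: contrapT => /(@acyclic_edge_radicals R)[jL sL].
  apply: (@left_mul_neq0 R _ (edge_path e)).
  case: ssA => ssA; first by rewrite -/A ssA in jL.
  by rewrite -/A ssA in sL.
split.
- by split=> h; [case: (trans_ss (ss_trans (or_introl h)))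
               |case: (trans_ss (ss_trans (or_intror h)))].
- by split=> h; [apply: ss_trans; right|case: (trans_ss h)].
move=> finV; have finrad := no_return_ideal_radicals (R := R) finV.
apply/seteqP; split=> T radT.
  by have [] := finrad T (rad_sub T (or_introl radT)).
by have [] := finrad T (rad_sub T (or_intror radT)).
Qed.
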